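(* For all integers $n, d\ge1$ and $1\le r\le n$, $$h_r(\Delta_n^d) \;=\; \sum_{s} b_{n,d}(s) \;=\; b_{n,d+1}(\Delta_r),$$ where the sum is over all simple $n$-braids $s$ that are right divisible by $\Delta_r$.
   Context: Braids. $B_n$ ($n\ge1$) is the braid group with generators $\sigma_1,\dots,\sigma_{n-1}$ and relations $\sigma_i\sigma_j=\sigma_j\sigma_i$ for $|i-j|\ge2$, $\sigma_i\sigma_j\sigma_i=\sigma_j\sigma_i\sigma_j$ for $|i-j|=1$; $B_\infty$ is the direct limit of the $B_n$. $B_n^+$, $B_\infty^+$ are the monoids with the same presentations; they embed in the groups and their elements are called positive braids. For positive braids, $x\preccurlyeq y$ means $y=xt$ for some positive braid $t$ ($x$ is a left divisor of $y$); $y$ is right divisible by $x$ if $y=tx$ for some positive braid $t$. $\mathrm{Div}(y)=\{x\in B_\infty^+ : x\preccurlyeq y\}$. $\Delta_1=1$ and $\Delta_n=\sigma_1\sigma_2\cdots\sigma_{n-1}\Delta_{n-1}$. Normal form. Simple $n$-braids are the elements of $\mathrm{Div}(\Delta_n)$. $(B_n^+,\preccurlyeq)$ is a lattice. A sequence $(s_1,\dots,s_d)$ of simple $n$-braids is normal if $s_k=\gcd(\Delta_n,s_k s_{k+1}\cdots s_d)$ (greatest common left divisor) for each $k$. Every $x\in B_n^+$ has a unique normal expression, which is completed on the right by infinitely many trivial factors $1$; its $d$th entry is the $d$th factor of $x$. The degree of $x$ is the largest $d$ such that the $d$th factor of $x$ is not $1$ (and is $0$ for $x=1$); $\mathrm{Div}(\Delta_n^d)$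 consists of the elements of $B_n^+$ of degree at most $d$. For a simple $n$-braid $s$, $b_{n,d}(s)$ is the number of elements of $B_n^+$ of degree at most $d$ (i.e., of divisors of $\Delta_n^d$) whose $d$th factor is $s$. Heights. The main generator of a nonempty word in the $\sigma_i^{\pm1}$ is $\sigma_m$ where $m$ is the largest index such that $\sigma_m$ or $\sigma_m^{-1}$ occurs; the word is $\sigma$-positive if its main generator $\sigma_m$ occurs but $\sigma_m^{-1}$ does not. For $r\ge1$, $x<_r y$ means that $x^{-1}y$ has a $\sigma$-positive expression whose main generator is $\sigma_m$ with $m\ge r$; this is a strict partial order. The $r$-height $h_r(z)$ of a positive braid $z$ is the maximal length (number of elements) of a $<_r$-chain contained in $\mathrm{Div}(z)$. *)

(* Defs.v *)
From HB Require Import structures.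
From mathcomp Require Import all_boot finmap.
From mathcomp Require Import boolp classical_sets cardinality.

Set Implicit Arguments.
Unset Strict Implicit.
Unset Printing Implicit Defensive.

Local Open Scope classical_set_scope.
Local Open Scope quotient_scope.
Local Open Scope group_scope.

(* The smallest monoid congruence on words that contains R. *)
Inductive pcong (T : Type) (R : seq T -> seq T -> Prop) :
    seq T -> seq T -> Prop :=
| pcong_rel u v : R u v -> pcong R u v
| pcong_refl u : pcong R u u
| pcong_sym u v : pcong R u v -> pcong R v u
| pcong_trans u v w : pcong R u v -> pcong R v w -> pcong R u w
| pcong_cat u u' v v' :
    pcong R u u' -> pcong R v v' -> pcong R (u ++ v) (u' ++ v').

Definition pcongb (T : Type) (R : seq T -> seq T -> Prop) : rel (seq T) :=
  fun u v => `[< pcong R u v >].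

Lemma pcongb_equiv (T : Type) (R : seq T -> seq T -> Prop) :
  equiv_class_of (pcongb R).
Proof.
split.
- by move=> u; apply/asboolP; exact: pcong_refl.
- by move=> u v; apply/asboolP/asboolP => /pcong_sym.
- move=> v u w /asboolP uv /asboolP vw; apply/asboolP.
  exact: pcong_trans uv vw.
Qed.

Canonical pcongb_equivRel (T : Type) (R : seq T -> seq T -> Prop) :=
  EquivRelPack (pcongb_equiv R).

Definition presented (T : choiceType) (R : seq T -> seq T -> Prop) : Type :=
  {eq_quot (pcongb R)}.

HB.instance Definition _ (T : choiceType) (R : seq T -> seq T -> Prop) :=
  Choice.copy (presented R) {eq_quot (pcongb R)}.
HB.instance Definition _ (T : choiceType) (R : seq T -> seq T -> Prop) :=
  EqQuotient.copy (presented R) {eq_quot (pcongb R)}.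

Lemma presentedP (T : choiceType) (R : seq T -> seq T -> Prop) (u v : seq T) :
  \pi_(presented R) u = \pi_(presented R) v <-> pcong R u v.
Proof. by split=> [/eqquotP/asboolP|uv] //; apply/eqquotP/asboolP. Qed.

Lemma pcong_repr (T : choiceType) (R : seq T -> seq T -> Prop) (u : seq T) :
  pcong R (repr (\pi_(presented R) u)) u.
Proof. by apply/presentedP; rewrite reprK. Qed.

Definition presented_one (T : choiceType) (R : seq T -> seq T -> Prop) :
  presented R := \pi_(presented R) [::].

Definition presented_mul (T : choiceType) (R : seq T -> seq T -> Prop)
  (x y : presented R) : presented R := \pi_(presented R) (repr x ++ repr y).

Lemma presented_mulE (T : choiceType) (R : seq T -> seq T -> Prop)
    (u v : seq T) :
  presented_mul (\pi_(presented R) u) (\pi_(presented R) v) =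
  \pi_(presented R) (u ++ v).
Proof. by apply/presentedP; apply: pcong_cat; exact: pcong_repr. Qed.

Lemma presentedW (T : choiceType) (R : seq T -> seq T -> Prop)
    (P : presented R -> Prop) :
  (forall u, P (\pi_(presented R) u)) -> forall x, P x.
Proof. by move=> Ppi x; rewrite -[x]reprK. Qed.

Lemma presented_mulA (T : choiceType) (R : seq T -> seq T -> Prop) :
  associative (@presented_mul T R).
Proof.
elim/presentedW => u; elim/presentedW => v; elim/presentedW => w.
by rewrite 2!presented_mulE [in RHS]presented_mulE presented_mulE catA.
Qed.

Lemma presented_mul1 (T : choiceType) (R : seq T -> seq T -> Prop) :
  left_id (presented_one R) (@presented_mul T R).
Proof. by elim/presentedW => u; rewrite presented_mulE. Qed.

Lemma presented_mul1r (T : choiceType) (R : seq T -> seq T -> Prop) :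
  right_id (presented_one R) (@presented_mul T R).
Proof. by elim/presentedW => u; rewrite presented_mulE cats0. Qed.

HB.instance Definition _ (T : choiceType) (R : seq T -> seq T -> Prop) :=
  isMonoid.Build (presented R)
    (@presented_mulA T R) (@presented_mul1 T R) (@presented_mul1r T R).

(* Letters are 0-based: in positive words i stands for sigma_(i+1), and in
   signed words (i, true) stands for sigma_(i+1), (i, false) for its inverse. *)
Inductive braid_rel : seq nat -> seq nat -> Prop :=
| braid_far i j : (i.+2 <= j)%N || (j.+2 <= i)%N ->
    braid_rel [:: i; j] [:: j; i]
| braid_near i j : (j == i.+1) || (i == j.+1) ->
    braid_rel [:: i; j; i] [:: j; i; j].

Definition pos_letter (i : nat) : nat * bool := (i, true).

Inductive signed_braid_rel : seq (nat * bool) -> seq (nat * bool) -> Prop :=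
| signed_braid u v : braid_rel u v ->
    signed_braid_rel [seq pos_letter i | i <- u] [seq pos_letter i | i <- v]
| signed_cancel i b : signed_braid_rel [:: (i, b); (i, ~~ b)] [::].

(* B_oo^+ and B_oo; the direct limit of the B_n has the union of their
   presentations as a presentation. *)
Definition pbraid : Type := presented braid_rel.
Definition braid : Type := presented signed_braid_rel.

HB.instance Definition _ := Monoid.on pbraid.
HB.instance Definition _ := EqQuotient.on pbraid.
HB.instance Definition _ := Monoid.on braid.
HB.instance Definition _ := EqQuotient.on braid.

Definition winv (w : seq (nat * bool)) : seq (nat * bool) :=
  rev [seq (a.1, ~~ a.2) | a <- w].

Lemma winv_cat u v : winv (u ++ v) = winv v ++ winv u.
Proof. by rewrite /winv map_cat rev_cat. Qed.

Lemma winvK : involutive winv.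
Proof.
move=> w; rewrite /winv map_rev revK -map_comp map_id_in // => -[i b] _ /=.
by rewrite negbK.
Qed.

Lemma winv_mul w : pcong signed_braid_rel (winv w ++ w) [::].
Proof.
elim: w => [|[i b] w IHw]; first exact: pcong_refl.
rewrite -cat1s winv_cat -catA (catA (winv [:: (i, b)])).
apply: pcong_trans IHw; apply: pcong_cat; first exact: pcong_refl.
rewrite -[X in pcong _ _ X]cat0s; apply: pcong_cat; last exact: pcong_refl.
by apply: pcong_rel; rewrite /winv /= -{2}[b]negbK; exact: signed_cancel.
Qed.

Definition braid_inv (x : braid) : braid := \pi_braid (winv (repr x)).

Lemma braid_mulV : left_inverse (1 : braid) braid_inv (fun x y => x * y).
Proof.
move=> x; rewrite -[X in _ * X]reprK.
by rewrite [LHS]presented_mulE; apply/presentedP; exact: winv_mul.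
Qed.

Lemma braid_mulrV : right_inverse (1 : braid) braid_inv (fun x y => x * y).
Proof.
move=> x; rewrite -[X in X * _]reprK.
rewrite [LHS]presented_mulE; apply/presentedP.
by rewrite -[X in X ++ _]winvK; exact: winv_mul.
Qed.

HB.instance Definition _ := hasInv.Build braid braid_inv.
HB.instance Definition _ := Monoid_isGroup.Build braid braid_mulV braid_mulrV.

Definition braid_of_pos (x : pbraid) : braid :=
  \pi_braid [seq pos_letter i | i <- repr x].

Lemma pcong_pos (u v : seq nat) : pcong braid_rel u v ->
  pcong signed_braid_rel
    [seq pos_letter i | i <- u] [seq pos_letter i | i <- v].
Proof.
elim=> {u v}.
- by move=> u v uv; apply: pcong_rel; exact: signed_braid.
- by move=> u; exact: pcong_refl.
- by move=> u v _ /pcong_sym.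
- by move=> u v t _ uv _; exact: pcong_trans.
- by move=> u u' v v' _ uu' _ vv'; rewrite !map_cat; exact: pcong_cat.
Qed.

Lemma braid_of_posE (w : seq nat) :
  braid_of_pos (\pi_pbraid w) = \pi_braid [seq pos_letter i | i <- w].
Proof. by apply/presentedP/pcong_pos; exact: pcong_repr. Qed.

Lemma braid_of_pos_morph : monoid_morphism braid_of_pos.
Proof.
split; first exact: (braid_of_posE [::]).
elim/presentedW => u; elim/presentedW => v; rewrite [X in braid_of_pos X]presented_mulE.
by rewrite !braid_of_posE [RHS]presented_mulE map_cat.
Qed.

HB.instance Definition _ :=
  isUMagmaMorphism.Build pbraid braid braid_of_pos braid_of_pos_morph.

(* sigma i is the generator sigma_(i+1). *)
Definition sigma (i : nat) : pbraid := \pi_pbraid [:: i].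

(* B_n^+ as a submonoid of B_oo^+. *)
Definition pbraid_n (n : nat) : set pbraid :=
  [set x | exists2 w : seq nat, all (fun i => (i.+1 < n)%N) w & x = \pi_pbraid w].

(* Delta 1 = 1 is an instance of the recursion; Delta 0 is a dummy value. *)
Fixpoint Delta (n : nat) : pbraid :=
  if n is m.+1 then (\prod_(i < m) sigma i) * Delta m else 1.

Definition ldiv (x y : pbraid) : Prop := exists t : pbraid, y = x * t.
Definition rdiv (x y : pbraid) : Prop := exists t : pbraid, y = t * x.
Definition Div (y : pbraid) : set pbraid := [set x | ldiv x y].

Definition is_lgcd (x y g : pbraid) : Prop :=
  [/\ ldiv g x, ldiv g y & forall h, ldiv h x -> ldiv h y -> ldiv h g].

Definition simple (n : nat) : set pbraid := Div (Delta n).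

Definition normal (n : nat) (s : seq pbraid) : Prop :=
  (forall x, x \in s -> simple n x) /\
  forall k, (k < size s)%N ->
    is_lgcd (Delta n) (\prod_(x <- drop k s) x) (nth 1 s k).

(* The d-th factor, 1 <= d, of an element of B_n^+. Normal expressions may end
   with factors 1, and nth completes them with further ones. *)
Definition factor (n d : nat) (x : pbraid) : pbraid :=
  xget 1 [set a | exists s : seq pbraid,
    [/\ normal n s, \prod_(y <- s) y = x & a = nth 1 s d.-1]].

(* Maximum of a set of integers, 0 if the set is empty (or unbounded). *)
Definition nat_max (A : set nat) : nat :=
  xget 0%N [set k | A k /\ forall j, A j -> (j <= k)%N].

Definition degree (n : nat) (x : pbraid) : nat :=
  nat_max [set d | (1 <= d)%N /\ factor n d x <> 1].

(* b_(n,d)(s). fset_set of an infinite set would be empty; a braid of degree at most d is a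
   product of d simple braids, so that this set is finite. *)
Definition card_factor (n d : nat) (s : pbraid) : nat :=
  #|` fset_set [set x | [/\ pbraid_n n x, (degree n x <= d)%N
                          & factor n d x = s]]|.

(* 0-based, like letters: the main generator of w is sigma_(main_letter w + 1). *)
Definition main_letter (w : seq (nat * bool)) : nat := \max_(a <- w) a.1.

Definition sigma_positive (w : seq (nat * bool)) : bool :=
  ((main_letter w, true) \in w) && ((main_letter w, false) \notin w).

Definition lt_braid (r : nat) : rel pbraid := fun x y =>
  `[< exists w : seq (nat * bool),
        [/\ sigma_positive w, (r <= (main_letter w).+1)%N
          & \pi_braid w = (braid_of_pos x)^-1 * braid_of_pos y] >].

(* Chains are listed in increasing order. *)
Definition height (r : nat) (z : pbraid) : nat :=
  nat_max [set k | exists c : seq pbraid,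
    [/\ size c = k, sorted (lt_braid r) c & forall x, x \in c -> Div z x]].

(* Main.v *)
(* A <_r-chain meets each left coset of B_r at most once, because a
   sigma-positive word is never trivial; and two elements of Div(z) lying in
   different cosets are always comparable.  So h_r(Delta_n^d) counts the cosets
   of B_r that meet Div(Delta_n^d).  Each of them contains exactly one x such
   that no x sigma_i with i < r stays in Div(Delta_n^d); these x are the ones
   whose d-th factor is right divisible by Delta_r, and x |-> x Delta_r sends
   them to the normal sequences of length d + 1 ending with Delta_r.

   Nontriviality of sigma-positive words: sigma_m acts on sequences of pairs of
   positive rationals by a subtraction-free form of Dynnikov's formulas, which
   strictly increases one coordinate that letters of smaller index fix.

   Comparability, by induction on the largest index m: the cosets of B_m that
   meet Div(z) form a finite graph under right multiplication by sigma_m, it is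
   acyclic, and all its vertices lead to the coset of z.  It is therefore enough
   to compare two predecessors x, y of one coset.  Then y = x sigma_m u sigma_m^-1
   with u in B_m; by induction u is in B_(m-1), or sigma_(m-1)-positive, or
   sigma_(m-1)-negative.  In the first case u commutes with sigma_m; in the
   second one, sigma_m sigma_(m-1) sigma_m^-1 = sigma_(m-1)^-1 sigma_m sigma_(m-1)
   makes sigma_m u sigma_m^-1 sigma_m-positive, along a path that remains in
   Div(z); the third one is symmetric. *)

Require Import Defs.
From mathcomp Require Import all_boot finmap.
From mathcomp Require Import boolp classical_sets cardinality.
From mathcomp Require Import all_order ssralg ssrnum ssrint rat.
From mathcomp Require Import zify ring.

Set Implicit Arguments.
Unset Strict Implicit.
Unset Printing Implicit Defensive.

Local Open Scope classical_set_scope.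
Local Open Scope quotient_scope.
Local Open Scope group_scope.

(** * Positive braids *)

Notation adj i j := ((j == i.+1) || (i == j.+1)).
Notation far i j := ((i.+2 <= j)%N || (j.+2 <= i)%N).

Definition pb (w : seq nat) : pbraid := \pi_pbraid w.

Lemma pb_cat u v : pb (u ++ v) = pb u * pb v.
Proof. by rewrite [RHS]presented_mulE. Qed.

Lemma pb_nil : pb [::] = 1.
Proof. by []. Qed.

Lemma pb_seq1 i : pb [:: i] = sigma i.
Proof. by []. Qed.

Lemma pb_cons i w : pb (i :: w) = sigma i * pb w.
Proof. by rewrite -cat1s pb_cat. Qed.

(* Keeps conversion tests from unfolding the choice of representatives. *)
#[global] Opaque presented_mul presented_one repr.

Lemma pbP u v : pb u = pb v <-> pcong braid_rel u v.
Proof. exact: presentedP. Qed.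

Lemma pb_repr (x : pbraid) : pb (repr x) = x.
Proof. exact: reprK. Qed.

Lemma pbraid_ind (P : pbraid -> Prop) :
  P 1 -> (forall i x, P x -> P (sigma i * x)) -> forall x, P x.
Proof.
move=> P1 PS x; rewrite -[x]pb_repr.
by elim: (repr x) => [|i w IH]; rewrite ?pb_cons //; apply: PS.
Qed.

Lemma pbraid_case (x : pbraid) : x = 1 \/ exists i y, x = sigma i * y.
Proof. by elim/pbraid_ind: x => [|i x _]; [left|right; exists i, x]. Qed.

Lemma sigmaC i j : far i j ->
  sigma i * sigma j = sigma j * sigma i.
Proof.
by move=> h; rewrite -!pb_seq1 -!pb_cat; apply/pbP/pcong_rel/braid_far.
Qed.

Lemma sigma_braid i j : adj i j ->
  sigma i * (sigma j * sigma i) = sigma j * (sigma i * sigma j).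
Proof.
by move=> h; rewrite -!pb_seq1 -!pb_cat; apply/pbP/pcong_rel/braid_near.
Qed.

Lemma sigmaCA i j x : far i j ->
  sigma i * (sigma j * x) = sigma j * (sigma i * x).
Proof. by move=> h; rewrite !mulgA sigmaC. Qed.

Lemma sigma_braidA i j x : adj i j ->
  sigma i * (sigma j * (sigma i * x)) = sigma j * (sigma i * (sigma j * x)).
Proof. by move=> /sigma_braid/(congr1 (fun t => t * x)); rewrite -!mulgA. Qed.

(** * Length, support and reversal of positive braids *)

Lemma pcong_size u v : pcong braid_rel u v -> size u = size v.
Proof.
elim=> {u v} [u v []||||] //; first by move=> u v w _ -> _ ->.
by move=> u u' v v' _ e1 _ e2; rewrite !size_cat e1 e2.
Qed.

Lemma pcong_all (p : pred nat) u v : pcong braid_rel u v -> all p u = all p v.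
Proof.
elim=> {u v} [u v []||u v _ ->|u v w _ -> _ ->|] //=.
- by move=> i j _; rewrite andbCA.
- by move=> i j _; case: (p i); case: (p j).
- by move=> u u' v v' _ e1 _ e2; rewrite !all_cat e1 e2.
Qed.

Lemma pcong_rev u v : pcong braid_rel u v -> pcong braid_rel (rev u) (rev v).
Proof.
elim=> {u v} [u v []||||].
- by move=> i j h; apply: pcong_rel; apply: braid_far; rewrite orbC.
- by move=> i j h; apply: pcong_rel; apply: braid_near.
- by move=> u; apply: pcong_refl.
- by move=> u v _; apply: pcong_sym.
- by move=> u v w _ h1 _; apply: pcong_trans h1.
- by move=> u u' v v' _ h1 _ h2; rewrite !rev_cat; apply: pcong_cat.
Qed.

Definition len (x : pbraid) : nat := size (repr x).

Arguments len x%_g.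

Lemma len_pb w : len (pb w) = size w.
Proof. by apply/pcong_size/pbP; rewrite pb_repr. Qed.

Lemma lenM x y : len (x * y) = (len x + len y)%N.
Proof. by rewrite -[x]pb_repr -[y]pb_repr -pb_cat !len_pb size_cat. Qed.

Lemma len1 : len 1 = 0%N.
Proof. exact: (len_pb [::]). Qed.

Lemma len_sigma i : len (sigma i) = 1%N.
Proof. exact: (len_pb [:: i]). Qed.

Lemma len_eq0 x : len x = 0%N -> x = 1.
Proof. by rewrite -[x]pb_repr len_pb => /size0nil ->. Qed.

(* The monoid B_(m+1)^+: letters are 0-based. *)
Definition low (m : nat) (x : pbraid) : bool := all (fun i => i < m)%N (repr x).

Arguments low m%_N x%_g.

Lemma low_pb m w : low m (pb w) = all (fun i => i < m)%N w.
Proof. by apply/pcong_all/pbP; rewrite pb_repr. Qed.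

Lemma lowM m x y : low m (x * y) = low m x && low m y.
Proof. by rewrite -[x]pb_repr -[y]pb_repr -pb_cat !low_pb all_cat. Qed.

Lemma low1 m : low m 1.
Proof. by rewrite -pb_nil low_pb. Qed.

Lemma low_sigma m i : low m (sigma i) = (i < m)%N.
Proof. by rewrite -pb_seq1 low_pb /= andbT. Qed.

Lemma lowW m n x : (m <= n)%N -> low m x -> low n x.
Proof.
by move=> mn; apply: sub_all => i im; apply: leq_trans mn.
Qed.

Lemma pbraid_nP n x : pbraid_n n x <-> low n.-1 x.
Proof.
have nP : (fun i => i.+1 < n)%N =1 (fun i => i < n.-1)%N by move=> i /=; lia.
split=> [[w lw ->]|lx]; first by rewrite low_pb -(eq_all nP).
by exists (repr x); rewrite ?reprK // (eq_all nP).
Qed.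

Lemma low_ind m (P : pbraid -> Prop) :
  P 1 -> (forall i x, (i < m)%N -> low m x -> P x -> P (sigma i * x)) ->
  forall x, low m x -> P x.
Proof.
move=> P1 PS; elim/pbraid_ind => // i x IH.
by rewrite lowM low_sigma => /andP[im lx]; apply: PS => //; apply: IH.
Qed.

(** An anti-automorphism fixing each generator; it carries results on left divisors over to right
    divisors. *)
Definition rv (x : pbraid) : pbraid := pb (rev (repr x)).

Lemma rv_pb w : rv (pb w) = pb (rev w).
Proof. by apply/pbP/pcong_rev/pbP; rewrite pb_repr. Qed.

Lemma rvM x y : rv (x * y) = rv y * rv x.
Proof. by rewrite -[x]pb_repr -[y]pb_repr -pb_cat !rv_pb rev_cat pb_cat. Qed.

Lemma rv1 : rv 1 = 1.
Proof. exact: (rv_pb [::]). Qed.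

Lemma rv_sigma i : rv (sigma i) = sigma i.
Proof. exact: (rv_pb [:: i]). Qed.

Lemma rvK : involutive rv.
Proof. by move=> x; rewrite -[x]pb_repr !rv_pb revK. Qed.

Lemma low_rv m x : low m (rv x) = low m x.
Proof. by rewrite -[x]pb_repr rv_pb !low_pb all_rev. Qed.

Lemma rdiv_rv x y : rdiv x y <-> ldiv (rv x) (rv y).
Proof.
split=> [[t ->]|[t e]]; first by exists (rv t); rewrite rvM.
by exists (rv t); rewrite -[y]rvK e rvM rvK.
Qed.

#[global] Opaque len low rv pb sigma.

Lemma low_ind_r m (P : pbraid -> Prop) :
  P 1 -> (forall i x, (i < m)%N -> low m x -> P x -> P (x * sigma i)) ->
  forall x, low m x -> P x.
Proof.
move=> P1 PS x; rewrite -low_rv -[in P x](rvK x).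
move: (rv x); apply: low_ind => [|i y im ly IH]; first by rewrite rv1.
by rewrite rvM rv_sigma; apply: PS; rewrite ?low_rv.
Qed.

(* [sigma i * cof i j] is the right lcm of [sigma i] and [sigma j]. *)
Definition cof (i j : nat) : pbraid :=
  if i == j then 1
  else if adj i j then sigma j * sigma i else sigma j.

Lemma cofii i : cof i i = 1.
Proof. by rewrite /cof eqxx. Qed.

Lemma cof_adj i j : adj i j -> cof i j = sigma j * sigma i.
Proof. by rewrite /cof => h; case: eqP => [e|_]; [lia | rewrite h]. Qed.

Lemma cof_far i j : far i j -> cof i j = sigma j.
Proof. by rewrite /cof => h; case: ifP; [lia | case: ifP => //; lia]. Qed.

Variant nat_adj_spec (i j : nat) : Prop :=
| AdjEq of i = j
| AdjAdj of adj i j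
| AdjFar of far i j.

Lemma nat_adjP i j : nat_adj_spec i j.
Proof.
have [|] := boolP (adj i j); first exact: AdjAdj.
by have [/eqP e _|ne nn] := boolP (i == j); [exact: AdjEq|apply: AdjFar; lia].
Qed.

Lemma adj_sym i j : adj i j -> adj j i.
Proof. by rewrite orbC. Qed.
Lemma far_sym i j : far i j -> far j i.
Proof. by rewrite orbC. Qed.

Lemma mul_cof i j : sigma i * cof i j = sigma j * cof j i.
Proof.
case: (nat_adjP i j) => [->|h|h]; first reflexivity.
- have h' := adj_sym h.
  by rewrite (cof_adj h) (cof_adj h'); apply: sigma_braid.
- have h' := far_sym h.
  by rewrite (cof_far h) (cof_far h'); apply: sigmaC.
Qed.


Lemma adj_adj i j k : adj i k -> adj j k ->
  i = j \/ far i j.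
Proof. lia. Qed.

(** The conclusion of Garside's lemma: both sides of [sigma i * a = sigma j * b] factor through the
    right lcm of the two generators. *)
Definition confl (i : nat) (a : pbraid) (j : nat) (b : pbraid) : Prop :=
  exists c, a = cof i j * c /\ b = cof j i * c.

Lemma confl_sym i a j b : confl i a j b -> confl j b i a.
Proof. by case=> c [ea eb]; exists c. Qed.

(** * Garside's lemma, lcms and gcds *)

Definition garside_below (L : nat) : Prop :=
  forall i a j b, (len a < L)%N -> sigma i * a = sigma j * b -> confl i a j b.

Section Garside.

Variable L : nat.
Hypothesis IHL : garside_below L.

Lemma cancel_below i a b : (len a < L)%N ->
  sigma i * a = sigma i * b -> a = b.
Proof.
move=> la e; have [c [-> ->]] := IHL la e.
by rewrite cofii.
Qed.

Lemma far_below i a j b : (len a < L)%N -> far i j ->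
  sigma i * a = sigma j * b ->
  exists c, [/\ a = sigma j * c, b = sigma i * c, len a = (len c).+1
              & len b = (len c).+1].
Proof.
move=> la h e; have [c [ea eb]] := IHL la e; exists c.
move: ea eb; rewrite (cof_far h) (cof_far (far_sym h)) => -> ->.
by rewrite !lenM !len_sigma.
Qed.

Lemma adj_below i a j b : (len a < L)%N -> adj i j ->
  sigma i * a = sigma j * b ->
  exists c, [/\ a = sigma j * (sigma i * c), b = sigma i * (sigma j * c),
                len a = (len c).+2 & len b = (len c).+2].
Proof.
move=> la h e; have [c [ea eb]] := IHL la e; exists c.
move: ea eb; rewrite (cof_adj h) (cof_adj (adj_sym h)) => -> ->.
by rewrite -!mulgA !lenM !len_sigma.
Qed.

Lemma confl_far i j c d f : far i j ->
  c = sigma j * f -> d = sigma i * f -> confl i c j d.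
Proof.
move=> h -> ->; exists f.
by rewrite (cof_far h) (cof_far (far_sym h)); split; reflexivity.
Qed.

Lemma confl_adj i j c d f : adj i j ->
  c = sigma j * (sigma i * f) -> d = sigma i * (sigma j * f) -> confl i c j d.
Proof.
move=> h -> ->; exists f.
by rewrite (cof_adj h) (cof_adj (adj_sym h)) -!mulgA; split; reflexivity.
Qed.

Section Cases.

Variables (i j k : nat) (c d : pbraid).

(** This lemma and the next four cover, up to exchanging [i] and [j], the possible triples of
    distinct generators, [k] being the first letter of an intermediate word. Each one applies the
    length-bounded hypothesis until a common tail appears. *)
Lemma confl_all_far : (len c < L)%N -> far i k -> far k j -> far i j ->
  sigma i * c = sigma j * d -> confl i (sigma k * c) j (sigma k * d).
Proof.
move=> lc ik kj ij e.
have [f [ec ed _ _]] := far_below lc ij e.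
apply: (@confl_far _ _ _ _ (sigma k * f)) => //.
  by rewrite ec sigmaCA.
by rewrite ed sigmaCA //; apply: far_sym.
Qed.

Lemma confl_far_far_adj : (len c < L)%N -> far i k -> far k j -> adj i j ->
  sigma i * c = sigma j * d -> confl i (sigma k * c) j (sigma k * d).
Proof.
move=> lc ik kj ij e.
have [f [ec ed _ _]] := adj_below lc ij e.
apply: (@confl_adj _ _ _ _ (sigma k * f)) => //.
  by rewrite ec (sigmaCA _ kj) (sigmaCA _ (far_sym ik)).
by rewrite ed (sigmaCA _ (far_sym ik)) (sigmaCA _ kj).
Qed.

Lemma confl_far_adj_far : (len c < L)%N -> far i k -> adj j k -> far i j ->
  sigma i * c = sigma j * (sigma k * d) ->
  confl i (sigma k * c) j (sigma k * (sigma j * d)).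
Proof.
move=> lc ik jk ij e.
have [f [ec ef l1 l2]] := far_below lc ij e.
have ld : (len d < L)%N by move: l2; rewrite lenM len_sigma; lia.
have [h [ed eh _ _]] := far_below ld (far_sym ik) ef.
apply: (@confl_far _ _ _ _ (sigma k * (sigma j * h))) => //.
  by rewrite ec eh (sigma_braidA _ jk).
by rewrite ed -(sigmaCA _ ij) -(sigmaCA _ ik).
Qed.

Lemma confl_far_adj_adj : (len c < L)%N -> far i k -> adj j k -> adj i j ->
  sigma i * c = sigma j * (sigma k * d) ->
  confl i (sigma k * c) j (sigma k * (sigma j * d)).
Proof.
move=> lc ik jk ij e.
have [f [ec ef l1 l2]] := adj_below lc ij e.
have ld : (len d < L)%N by move: l2; rewrite lenM len_sigma; lia.
have [h [ed eh l3 l4]] := far_below ld (far_sym ik) ef.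
have lf : (len f < L)%N by move: l4; rewrite lenM len_sigma; lia.
have [g [ef' eh' _ _]] := adj_below lf jk eh.
apply: (@confl_adj _ _ _ _ (sigma k * (sigma j * (sigma i * g)))) => //.
  rewrite ec ef' [in LHS](sigmaCA _ ik) -[in LHS](sigma_braidA _ jk).
  by rewrite -[in LHS](sigma_braidA _ ij) -[in LHS](sigmaCA _ ik).
rewrite ed eh' -[in LHS](sigma_braidA _ ij) [in LHS](sigmaCA _ ik).
by rewrite -[in LHS](sigmaCA _ ik) -[in LHS](sigma_braidA _ jk).
Qed.

Lemma confl_adj_adj_far : ((len c).+1 < L)%N -> adj i k -> adj j k -> far i j ->
  sigma i * (sigma k * c) = sigma j * (sigma k * d) ->
  confl i (sigma k * (sigma i * c)) j (sigma k * (sigma j * d)).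
Proof.
move=> lc ik jk ij e.
have lkc : (len (sigma k * c) < L)%N by rewrite lenM len_sigma.
have [f [ec ed l1 l2]] := far_below lkc ij e.
have ld : (len d < L)%N by move: l1 l2; rewrite !lenM !len_sigma; lia.
have [g [ec' ef _ l3]] := adj_below (ltnW lc) (adj_sym jk) ec.
have [h [ed' ef' _ l4]] := adj_below ld (adj_sym ik) ed.
have lf : (len (sigma j * g) < L)%N.
  by move: l1; rewrite ef !lenM !len_sigma; lia.
have lg : (len g < L)%N by move: lf; rewrite lenM len_sigma; lia.
(* Both expressions of [f] start with [sigma k]; cancelling it leaves an equation between the far
   letters [j] and [i]. *)
have [p [eg eh _ _]] :=
  far_below lg (far_sym ij) (cancel_below lf (etrans (esym ef) ef')).
apply: (@confl_far _ _ _ _ (sigma k * (sigma j * (sigma i * (sigma k * p))))) => //.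
  rewrite ec' eg [in LHS](sigmaCA _ ij) [in LHS](sigma_braidA _ ik).
  by rewrite -[in LHS](sigma_braidA _ jk).
rewrite ed' eh -[in LHS](sigmaCA _ ij) [in LHS](sigma_braidA _ jk).
by rewrite -[in LHS](sigma_braidA _ ik) [in LHS](sigmaCA _ ij).
Qed.

End Cases.

(** The two factorisations of the middle term [e] give an equation to which the bounded hypothesis
    applies. Length [L] is allowed for [e], since that hypothesis is used only after a letter has
    been removed. *)
Lemma confl_trans i j k a b e : (len e <= L)%N ->
  confl i a k e -> confl k e j b -> confl i a j b.
Proof.
case: (nat_adjP i k) => [<-|ik|ik] le; case=> c [ea ec].
  by move: ea ec; rewrite cofii mul1g => -> ->.
all: case: (nat_adjP k j) => [<-|kj|kj]; case=> d [ed eb].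
1,4: by move: ed eb; rewrite cofii mul1g => <- ->; exists c.
(* Four cases remain: each of the pairs [i], [k] and [k], [j] is adjacent or far. *)
all: move: le ec ed ea eb.
all: rewrite ?(cof_adj ik) ?(cof_adj (adj_sym ik)).
all: rewrite ?(cof_adj kj) ?(cof_adj (adj_sym kj)).
all: rewrite ?(cof_far ik) ?(cof_far (far_sym ik)).
all: rewrite ?(cof_far kj) ?(cof_far (far_sym kj)).
all: rewrite -?mulgA => le ec ed -> ->.
all: move: le ed; rewrite ec !lenM !len_sigma => le ed.
- have [ij|ij] := adj_adj ik (adj_sym kj).
    rewrite -ij in ed *.
    move/cancel_below: ed; rewrite lenM len_sigma => /(_ ltac:(lia)) ed.
    move/cancel_below: ed => /(_ ltac:(lia)) ->.
    by exists (sigma k * (sigma i * d)); rewrite cofii mul1g.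
  by apply: confl_adj_adj_far ik (adj_sym kj) ij ed; lia.
- have [ij|ij|ij] := nat_adjP i j.
  + by exfalso; move: ik kj; rewrite ij; lia.
  + apply: confl_sym; apply: confl_far_adj_adj;
      [ | exact: far_sym | exact: ik | exact: adj_sym | exact: esym ed].
    by move/(congr1 len): ed; rewrite !lenM !len_sigma; lia.
  + apply: confl_sym; apply: confl_far_adj_far;
      [ | exact: far_sym | exact: ik | exact: far_sym | exact: esym ed].
    by move/(congr1 len): ed; rewrite !lenM !len_sigma; lia.
- have [ij|ij|ij] := nat_adjP i j.
  + by exfalso; move: ik kj; rewrite ij; lia.
  + by apply: confl_far_adj_adj ik (adj_sym kj) ij ed; lia.
  + by apply: confl_far_adj_far ik (adj_sym kj) ij ed; lia.
- have [ij|ij|ij] := nat_adjP i j.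
  + rewrite -ij in ed *.
    move/cancel_below: ed => /(_ ltac:(lia)) ->.
    by exists (sigma k * d); rewrite cofii mul1g.
  + by apply: confl_far_far_adj ik kj ij ed; lia.
  + by apply: confl_all_far ik kj ij ed; lia.
Qed.
End Garside.

Lemma confl_refl i a : confl i a i a.
Proof. by exists a; rewrite cofii mul1g; split; reflexivity. Qed.

(** Induction on the derivation of the congruence. Transitivity is [confl_trans]; in a
    concatenation, the first letters come from the left factor unless it is empty. *)
Lemma pcong_confl L : garside_below L -> forall u v, pcong braid_rel u v ->
  forall i a j b, (size a <= L)%N -> u = i :: a -> v = j :: b ->
  confl i (pb a) j (pb b).
Proof.
move=> IHL u v; elim=> {u v}.
- move=> _ _ [] i j h _ a _ b _ [<- <-] [<- <-].
    by apply: (confl_far (f := 1) h); rewrite mulg1 pb_seq1; reflexivity.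
  by apply: (confl_adj (f := 1) h); rewrite mulg1 pb_cons pb_seq1; reflexivity.
- by move=> _ i a j b _ -> [<- <-]; apply: confl_refl.
- move=> u v e IH i a j b sa ev eu; apply: confl_sym; apply: (IH _ _ _ _ _ eu ev).
  by have := pcong_size e; rewrite eu ev /= => -[->].
- move=> u v w uv IH1 vw IH2 i a j b sa eu ew.
  have := pcong_size uv; rewrite eu; case ev: v => [//|k e] /= [sae].
  apply: (confl_trans IHL (k := k) (e := pb e)); first by rewrite len_pb -sae.
    exact: IH1 eu ev.
  by apply: IH2 ev ew; rewrite -sae.
- move=> u u' v v' uu' IH1 /pbP evv' IH2 i a j b sa.
  have := pcong_size uu'; case: u u' uu' IH1 => [|k u] [|k' u'] //= uu' IH1 _.
    exact: IH2.
  move=> [ei ea] [ej eb]; rewrite -ei -ej -ea -eb !pb_cat -evv'.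
  have [|c [-> ->]] := IH1 _ u _ u' _ erefl erefl.
    by move: sa; rewrite -ea size_cat; lia.
  by exists (c * pb v); rewrite -!mulgA; split; reflexivity.
Qed.

Theorem garside i a j b : sigma i * a = sigma j * b -> confl i a j b.
Proof.
suff H L : garside_below L by apply: (H (len a).+1).
elim: L => // L IH {}i {}a {}j {}b la.
rewrite -[a]pb_repr -[b]pb_repr -!pb_cons => /pbP e.
by apply: (pcong_confl IH e) => //; rewrite -len_pb pb_repr.
Qed.

Lemma mulpI (x a b : pbraid) : x * a = x * b -> a = b.
Proof.
elim/pbraid_ind: x a b => [|i x IH] a b; first by rewrite !mul1g.
rewrite -!mulgA => /garside[c [ea eb]]; apply: IH.
by rewrite ea eb cofii.
Qed.

Lemma rv_inj : injective rv.
Proof. exact: inv_inj rvK. Qed.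

Lemma mulIp (x a b : pbraid) : a * x = b * x -> a = b.
Proof. by move=> /(congr1 rv); rewrite !rvM => /mulpI/rv_inj. Qed.

(** * Divisibility, lcms and gcds *)

Lemma mulp_eq1 (x y : pbraid) : x * y = 1 -> x = 1 /\ y = 1.
Proof.
move=> /(congr1 len); rewrite lenM len1 => /eqP; rewrite addn_eq0.
by case/andP=> /eqP/len_eq0 -> /eqP/len_eq0 ->.
Qed.

Lemma ldiv_refl x : ldiv x x.
Proof. by exists 1; rewrite mulg1. Qed.

Lemma ldiv1 x : ldiv 1 x.
Proof. by exists x; rewrite mul1g. Qed.

Lemma ldiv_mulr x t : ldiv x (x * t).
Proof. by exists t. Qed.

Lemma ldiv_trans y x z : ldiv x y -> ldiv y z -> ldiv x z.
Proof. by case=> s -> [t ->]; exists (s * t); rewrite mulgA. Qed.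

Lemma ldiv_mul2l x a b : ldiv (x * a) (x * b) <-> ldiv a b.
Proof.
split=> [[t]|[t ->]]; last by exists t; rewrite mulgA.
by rewrite -mulgA => /mulpI ->; exists t.
Qed.

Lemma ldivW x t y : ldiv (x * t) y -> ldiv x y.
Proof. exact: ldiv_trans (ldiv_mulr x t). Qed.

Lemma ldiv_len x y : ldiv x y -> (len x <= len y)%N.
Proof. by case=> t ->; rewrite lenM leq_addr. Qed.

Lemma ldiv_len_eq x y : ldiv x y -> (len y <= len x)%N -> x = y.
Proof.
case=> t ->; rewrite lenM => h.
by have -> : t = 1; [apply: len_eq0; lia | rewrite mulg1].
Qed.

Lemma ldiv_anti x y : ldiv x y -> ldiv y x -> x = y.
Proof. by move=> xy /ldiv_len; apply: ldiv_len_eq. Qed.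

Lemma low_ldiv m x y : ldiv x y -> low m y -> low m x.
Proof. by case=> t ->; rewrite lowM => /andP[]. Qed.

Lemma sigma_lcm i j w :
  ldiv (sigma i) w -> ldiv (sigma j) w -> ldiv (sigma i * cof i j) w.
Proof.
case=> a -> [b /garside[c [-> _]]].
by exists c; rewrite mulgA; reflexivity.
Qed.

Definition is_lcm (x y m : pbraid) : Prop :=
  [/\ ldiv x m, ldiv y m & forall w, ldiv x w -> ldiv y w -> ldiv m w].

Lemma is_lcm_sym x y m : is_lcm x y m -> is_lcm y x m.
Proof. by case=> xm ym h; split=> // w yw xw; apply: h. Qed.

Lemma is_lcm1 x : is_lcm x 1 x.
Proof. by split=> //; [exact: ldiv_refl | exact: ldiv1]. Qed.

Lemma low_cof n i j : (i < n)%N -> (j < n)%N -> low n (cof i j).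
Proof.
rewrite /cof => hi hj; case: ifP; first by rewrite low1.
by case: ifP => _ _; rewrite ?lowM !low_sigma ?hi ?hj.
Qed.

(* The lcm is assembled from the square of [sigma i] and [sigma j] and three
   lcms below shorter elements. *)
Lemma lcm_exists_low z x y : ldiv x z -> ldiv y z ->
  exists2 m, is_lcm x y m & forall n, low n x -> low n y -> low n m.
Proof.
have [L] := ubnP (len z); elim: L => // L IH in z x y *; rewrite ltnS => lz.
case: (pbraid_case x) => [->|[i [x' ->]]] xz yz.
  by exists y => //; apply/is_lcm_sym/is_lcm1.
case: (pbraid_case y) yz => [->|[j [y' ->]]] yz.
  by exists (sigma i * x') => //; apply: is_lcm1.
case: (xz) (yz) => s ez [t ez'].
have [u eu] := sigma_lcm (ldivW xz) (ldivW yz).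
have [z1 [z2 [ez1 ez2]]] :
    exists z1 z2, z = sigma i * z1 /\ z = sigma j * z2.
  by exists (x' * s), (y' * t); rewrite !mulgA.
have e1 : z1 = cof i j * u.
  by apply: (@mulpI (sigma i)); rewrite mulgA -eu -ez1.
have e2 : z2 = cof j i * u.
  by apply: (@mulpI (sigma j)); rewrite mulgA -mul_cof -eu -ez2.
have l1 : (len z = (len z1).+1)%N by rewrite ez1 lenM len_sigma.
have l2 : (len z = (len z2).+1)%N by rewrite ez2 lenM len_sigma.
have xz1 : ldiv x' z1 by apply/(ldiv_mul2l (sigma i)); rewrite -ez1.
have yz2 : ldiv y' z2 by apply/(ldiv_mul2l (sigma j)); rewrite -ez2.
have pz1 : ldiv (cof i j) z1 by rewrite e1; apply: ldiv_mulr.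
have pz2 : ldiv (cof j i) z2 by rewrite e2; apply: ldiv_mulr.
have [|m1 [xm1 pm1 h1] low1] := IH z1 x' (cof i j) _ xz1 pz1; first by lia.
have [|m2 [ym2 pm2 h2] low2] := IH z2 y' (cof j i) _ yz2 pz2; first by lia.
case: pm1 pm2 => t1 em1 [t2 em2].
have t1u : ldiv t1 u.
  by apply/(ldiv_mul2l (cof i j)); rewrite -em1 -e1; apply: h1.
have t2u : ldiv t2 u.
  by apply/(ldiv_mul2l (cof j i)); rewrite -em2 -e2; apply: h2.
have lu : (len u <= len z1)%N by rewrite e1 lenM leq_addl.
have [|m3 [tm1 tm2 h3] low3] := IH u t1 t2 _ t1u t2u; first by lia.
exists (sigma i * (cof i j * m3)); last first.
  move=> n; rewrite !lowM !low_sigma => /andP[ni lx] /andP[nj ly].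
  rewrite ni (low_cof ni nj) /=; apply: low3.
    by have := low1 n lx (low_cof ni nj); rewrite em1 lowM => /andP[].
  by have := low2 n ly (low_cof nj ni); rewrite em2 lowM => /andP[].
split.
- apply/ldiv_mul2l; apply: ldiv_trans xm1 _; rewrite em1.
  exact/ldiv_mul2l.
- rewrite mulgA mul_cof -mulgA.
  apply/ldiv_mul2l; apply: ldiv_trans ym2 _; rewrite em2.
  exact/ldiv_mul2l.
- move=> w xw yw; have [w' ew] := sigma_lcm (ldivW xw) (ldivW yw).
  rewrite ew mulgA; apply/ldiv_mul2l; apply: h3.
    apply/(ldiv_mul2l (cof i j)); rewrite -em1; apply: h1.
      by apply/(ldiv_mul2l (sigma i)); rewrite mulgA -ew.
    exact: ldiv_mulr.
  apply/(ldiv_mul2l (cof j i)); rewrite -em2; apply: h2.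
    by apply/(ldiv_mul2l (sigma j)); rewrite mulgA -mul_cof -ew.
  exact: ldiv_mulr.
Qed.

Lemma lcm_exists z x y : ldiv x z -> ldiv y z -> exists m, is_lcm x y m.
Proof. by move=> xz yz; have [m hm _] := lcm_exists_low xz yz; exists m. Qed.

(** Take a common left divisor of maximal length: its lcm with any other one is again a common
    divisor, hence no longer than it. *)
Lemma gcd_exists x y : exists g, is_lgcd x y g.
Proof.
pose P k := `[< exists g, [/\ ldiv g x, ldiv g y & len g = k] >].
have exP : exists k, P k.
  exists 0%N; apply/asboolP; exists 1.
  by split; [exact: ldiv1 | exact: ldiv1 | exact: len1].
have ubP k : P k -> (k <= len x)%N by move=> /asboolP[g [/ldiv_len gx _ <-]].
have [k /asboolP[g [gx gy <-]] gmax] := ex_maxnP exP ubP.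
exists g; split=> // h hx hy.
have [m [hm gm mmin]] := lcm_exists hx gx.
rewrite (_ : g = m) //; apply: (ldiv_len_eq gm); apply: gmax.
by apply/asboolP; exists m; split=> //; apply: mmin.
Qed.

Lemma is_lgcd_uniq x y g h : is_lgcd x y g -> is_lgcd x y h -> g = h.
Proof.
case=> gx gy gm [hx hy hm].
by apply: ldiv_anti; [apply: hm | apply: gm].
Qed.

Lemma mirror_far i j a b : far i j -> a * sigma i = b * sigma j ->
  exists c, a = c * sigma j /\ b = c * sigma i.
Proof.
move=> h /(congr1 rv); rewrite !rvM !rv_sigma => /garside[c [ea eb]].
move: ea eb; rewrite (cof_far h) (cof_far (far_sym h)) => ea eb.
by exists (rv c); rewrite -[a]rvK -[b]rvK ea eb !rvM !rv_sigma.
Qed.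

Lemma mirror_adj i j a b : adj i j -> a * sigma i = b * sigma j ->
  exists c, a = c * sigma i * sigma j /\ b = c * sigma j * sigma i.
Proof.
move=> h /(congr1 rv); rewrite !rvM !rv_sigma => /garside[c [ea eb]].
move: ea eb; rewrite (cof_adj h) (cof_adj (adj_sym h)) => ea eb.
by exists (rv c); rewrite -[a]rvK -[b]rvK ea eb !rvM !rv_sigma !mulgA.
Qed.

(** The mirror image of [lcm_exists_low]: [c] is the left lcm of [x] and [y]. *)
Lemma rlcm_exists_low n x y z a b : low n x -> low n y ->
  z = a * x -> z = b * y ->
  exists c e f, [/\ low n c, c = e * x, c = f * y & rdiv c z].
Proof.
move=> lx ly /(congr1 rv); rewrite rvM => ea /(congr1 rv); rewrite rvM => eb.
have xz : ldiv (rv x) (rv z) by exists (rv a).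
have yz : ldiv (rv y) (rv z) by exists (rv b).
have [m [[s es] [t et] mm] lm] := lcm_exists_low xz yz.
exists (rv m), (rv s), (rv t); split.
- by rewrite low_rv lm // low_rv.
- by rewrite es rvM rvK.
- by rewrite et rvM rvK.
- by apply/rdiv_rv; rewrite rvK; apply: mm.
Qed.

(** * The braids Delta n and their divisors *)

Lemma iota_ramp m : pb (iota 0 m.+1) = pb (iota 0 m) * sigma m.
Proof. by rewrite -addn1 iotaD pb_cat. Qed.

Lemma DeltaS m : Delta m.+1 = pb (iota 0 m) * Delta m.
Proof.
rewrite /=; congr (_ * _); elim: m => [|m IH]; first by rewrite big_ord0.
by rewrite big_ord_recr /= IH iota_ramp.
Qed.

Lemma low_ramp m : low m (pb (iota 0 m)).
Proof. by rewrite low_pb; apply/allP => i; rewrite mem_iota. Qed.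

Lemma low_Delta m : low m.-1 (Delta m).
Proof.
elim: m => [|m IH]; first exact: low1.
rewrite DeltaS lowM low_ramp; apply: lowW IH; exact: leq_pred.
Qed.

Lemma low_sigmaC m i x : low m x -> (m < i)%N -> sigma i * x = x * sigma i.
Proof.
move=> lx mi; move: x lx; apply: low_ind => [|j x jm _ IH].
  by rewrite mul1g mulg1.
by rewrite -mulgA -IH sigmaCA //; lia.
Qed.

Lemma sigma_ramp m i : (i.+1 < m)%N ->
  sigma i.+1 * pb (iota 0 m) = pb (iota 0 m) * sigma i.
Proof.
elim: m => // m IH; rewrite ltnS leq_eqVlt => /orP[/eqP <-|im]; last first.
  by rewrite iota_ramp mulgA IH // -!mulgA sigmaC //; lia.
rewrite !iota_ramp !mulgA (low_sigmaC (low_ramp i)) // -!mulgA.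
by rewrite sigma_braid //; lia.
Qed.

Lemma Delta_ramp m : Delta m.+1 = Delta m * rv (pb (iota 0 m)).
Proof.
elim: m => [|m IH]; first by rewrite DeltaS rv1.
rewrite DeltaS iota_ramp rvM rv_sigma [in LHS]IH [in RHS]DeltaS -!mulgA.
congr (_ * _); rewrite !mulgA; congr (_ * _).
by case: m {IH} => [|m]; [rewrite mul1g mulg1 | apply: low_sigmaC (low_Delta _) _].
Qed.

Lemma rv_Delta m : rv (Delta m) = Delta m.
Proof.
elim: m => [|m IH]; first exact: rv1.
by rewrite {1}DeltaS rvM IH Delta_ramp.
Qed.

(** Conjugation by the half twist reverses the order of the generators. *)
Lemma sigma_Delta m i : (i < m)%N ->
  sigma i * Delta m.+1 = Delta m.+1 * sigma (m.-1 - i).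
Proof.
elim: m i => // m IH [_|i im]; last first.
  have -> : (m.+1.-1 - i.+1 = m.-1 - i)%N by lia.
  by rewrite DeltaS mulgA sigma_ramp // -[LHS]mulgA IH // mulgA.
(* Since [Delta] is a palindrome, reversal turns the case of [sigma 0] into that of the last
   generator, which [sigma_ramp] reduces to the induction hypothesis. *)
apply: rv_inj; rewrite (rvM (sigma 0)) (rvM (Delta _)) !rv_sigma rv_Delta subn0.
case: m IH => [|m] IH; last first.
  rewrite -[m.+2.-1]/(m.+1) DeltaS [RHS]mulgA sigma_ramp // -[RHS]mulgA IH //.
  by rewrite subnn [RHS]mulgA.
have -> // : Delta 2 = sigma 0.
by rewrite DeltaS DeltaS pb_nil pb_seq1 !mulg1.
Qed.

Lemma Delta_conjl n a : low n.-1 a ->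
  exists2 b, low n.-1 b & a * Delta n = Delta n * b.
Proof.
case: n => [|m]; first by exists a; rewrite // mul1g mulg1.
rewrite -[m.+1.-1]/m.
move: a; apply: low_ind => [|i x im _ [y ly e]].
  by exists 1; rewrite ?low1 // mul1g mulg1.
exists (sigma (m.-1 - i) * y); first by rewrite lowM low_sigma ly; lia.
by rewrite -[LHS]mulgA e [LHS]mulgA sigma_Delta // [RHS]mulgA.
Qed.

Lemma Delta_conjr n a : low n.-1 a ->
  exists2 b, low n.-1 b & Delta n * a = b * Delta n.
Proof.
move=> la; have [|b lb e] := @Delta_conjl n (rv a); first by rewrite low_rv.
exists (rv b); first by rewrite low_rv.
by apply: rv_inj; rewrite (rvM (Delta _)) (rvM (rv b)) rvK rv_Delta.
Qed.

(** If [Delta n = s * t], then [Delta n * t = t' * Delta n = t' * s * t] for some [t'], and [t]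
    cancels. *)
Lemma ldiv_Delta_rdiv n s : ldiv s (Delta n) -> rdiv s (Delta n).
Proof.
case=> t e.
have lt : low n.-1 t by have := low_Delta n; rewrite e lowM => /andP[].
have [t' _ et] := Delta_conjr lt; exists t'.
by apply: (@mulIp t); rewrite -[RHS]mulgA -e.
Qed.

Lemma rdiv_Delta_ldiv m s : rdiv s (Delta m) -> ldiv s (Delta m).
Proof.
move=> /rdiv_rv; rewrite rv_Delta => /ldiv_Delta_rdiv/rdiv_rv.
by rewrite rvK rv_Delta.
Qed.

Lemma sigma_ldiv_Delta n i : (i < n.-1)%N -> ldiv (sigma i) (Delta n).
Proof.
case: n => // m; rewrite -[m.+1.-1]/m; elim: m i => // m IH [_|i im].
  by rewrite DeltaS [iota _ _]/= pb_cons -mulgA; apply: ldiv_mulr.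
have [t e] := IH i im.
by exists (pb (iota 0 m.+1) * t); rewrite DeltaS e !mulgA sigma_ramp.
Qed.

(** * Permutations of the strands, and braids in which no two strands cross twice *)

Definition sw (i k : nat) : nat :=
  if k == i then i.+1 else if k == i.+1 then i else k.

Lemma swL i : sw i i = i.+1.
Proof. by rewrite /sw eqxx. Qed.

Lemma swR i : sw i i.+1 = i.
Proof. by rewrite /sw gtn_eqF // eqxx. Qed.

Lemma swN i k : k != i -> k != i.+1 -> sw i k = k.
Proof. by rewrite /sw => /negPf -> /negPf ->. Qed.

Lemma swK i : involutive (sw i).
Proof.
move=> k; have [->|ki] := eqVneq k i; first by rewrite swL swR.
have [->|ki'] := eqVneq k i.+1; first by rewrite swR swL.
by rewrite !swN.
Qed.

Lemma swP i k : k = i /\ sw i k = i.+1 \/ k = i.+1 /\ sw i k = i \/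
  k <> i /\ k <> i.+1 /\ sw i k = k.
Proof. by rewrite /sw; do 2?case: eqP => ?; [left | right; left | right; right]. Qed.

Lemma sw_far i j k : far i j -> sw i (sw j k) = sw j (sw i k).
Proof.
have := swP i (sw j k); have := swP j k; have := swP j (sw i k); have := swP i k.
lia.
Qed.

Lemma sw_adj_succ i k : sw i (sw i.+1 (sw i k)) = sw i.+1 (sw i (sw i.+1 k)).
Proof.
have [->|k0] := eqVneq k i.
  by rewrite swL swL (@swN i.+1 i) 1?(@swN i i.+2) ?swL //; lia.
have [->|k1] := eqVneq k i.+1.
  by rewrite swR swL (@swN i.+1 i) 1?(@swN i i.+2) ?swL ?swR //; lia.
have [->|k2] := eqVneq k i.+2.
  by rewrite swR swR (@swN i i.+2) 1?(@swN i.+1 i) ?swR //; lia.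
by rewrite !swN.
Qed.

Lemma sw_adj i j k : adj i j -> sw i (sw j (sw i k)) = sw j (sw i (sw j k)).
Proof. by case/orP=> /eqP ->; rewrite sw_adj_succ. Qed.

(* [strand w k] is the final position of the strand of w starting at k. *)
Definition strand (w : seq nat) (k : nat) : nat := foldl (fun k i => sw i k) k w.

(* No two strands cross twice; [f] gives their order at the end of [w]. *)
Fixpoint reduced_for (f : nat -> nat) (w : seq nat) : bool :=
  if w is i :: w' then
    reduced_for f w' && (f (strand w' i) < f (strand w' i.+1))%N
  else true.

Lemma strand_cat u v k : strand (u ++ v) k = strand v (strand u k).
Proof. by rewrite /strand foldl_cat. Qed.

Lemma reduced_cat f u v :
  reduced_for f (u ++ v) = reduced_for f v && reduced_for (f \o strand v) u.
Proof.
elim: u => [|i u IH] /=; first by rewrite andbT.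
by rewrite IH !strand_cat andbA.
Qed.

Lemma eq_reduced f g w : f =1 g -> reduced_for f w = reduced_for g w.
Proof. by move=> fg; elim: w => //= i w ->; rewrite !fg. Qed.

Lemma pcong_strand u v : pcong braid_rel u v -> strand u =1 strand v.
Proof.
elim=> {u v} [u v [] i j h k||u v _ h k|u v w _ h1 _ h2 k|u u' v v' _ h1 _ h2 k].
- exact/sw_far/far_sym.
- exact: sw_adj.
- by [].
- by rewrite h.
- by rewrite h1.
- by rewrite !strand_cat h1.
Qed.

Lemma pcong_reduced u v : pcong braid_rel u v ->
  forall f, reduced_for f u = reduced_for f v.
Proof.
elim=> {u v} [u v [] i j h f||u v _ h f|u v w _ h1 _ h2 f|u u' v v' _ h1 vv' h2 f].
- by rewrite /= /strand /= !(swN (i := i)) ?(swN (i := j)) //; lia.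
- have [e|e] : j = i.+1 \/ i = j.+1 by lia.
    rewrite e /= /strand /= !swL !swR !(@swN i i.+2) ?(@swN i.+1 i) ?swL ?swR; lia.
  rewrite e /= /strand /= !swL !swR !(@swN j j.+2) ?(@swN j.+1 j) ?swL ?swR; lia.
- by [].
- by rewrite h.
- by rewrite h1.
- rewrite !reduced_cat h1 h2; congr (_ && _); apply: eq_reduced => k /=.
  by rewrite (pcong_strand vv').
Qed.

Definition str (x : pbraid) : nat -> nat := strand (repr x).
Definition reduced (x : pbraid) : bool := reduced_for id (repr x).

Lemma str_pb w : str (pb w) =1 strand w.
Proof. by apply/pcong_strand/pbP; rewrite pb_repr. Qed.

Lemma reduced_pb w : reduced (pb w) = reduced_for id w.
Proof. by apply/pcong_reduced/pbP; rewrite pb_repr. Qed.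

#[global] Opaque str reduced.

Lemma strM x y k : str (x * y) k = str y (str x k).
Proof. by rewrite -[x]pb_repr -[y]pb_repr -pb_cat !str_pb strand_cat. Qed.

Lemma str1 k : str 1 k = k.
Proof. exact: (str_pb [::]). Qed.

Lemma str_sigma i k : str (sigma i) k = sw i k.
Proof. exact: (str_pb [:: i]). Qed.

Lemma reduced1 : reduced 1.
Proof. by rewrite -pb_nil reduced_pb. Qed.

Lemma reduced_sigma i x : reduced (sigma i * x) = reduced x && (str x i < str x i.+1)%N.
Proof. by rewrite -[x]pb_repr -pb_cons !reduced_pb !str_pb. Qed.

Lemma reduced_r x y : reduced (x * y) -> reduced y.
Proof.
by rewrite -[x]pb_repr -[y]pb_repr -pb_cat !reduced_pb reduced_cat => /andP[].
Qed.

Lemma str_rv x : cancel (str x) (str (rv x)).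
Proof.
elim/pbraid_ind: x => [|i x IH] k; first by rewrite rv1 !str1.
by rewrite rvM rv_sigma !strM !str_sigma IH swK.
Qed.

Lemma str_rvK x : cancel (str (rv x)) (str x).
Proof. by have := str_rv (rv x); rewrite rvK. Qed.

Lemma str_inj x : injective (str x).
Proof. exact: can_inj (str_rv x). Qed.

Lemma str_low m x k : low m x -> (m < k)%N -> str x k = k.
Proof.
move=> lx mk; move: x lx; apply: low_ind => [|i x im _ IH]; first exact: str1.
by rewrite strM str_sigma swN //; lia.
Qed.

(** The exchange property: a crossing between strands that start side by side can be performed
    first. *)
Lemma reduced_descent i x : reduced x -> (str x i.+1 < str x i)%N -> ldiv (sigma i) x.
Proof.
have [L] := ubnP (len x); elim: L => // L IH in i x *; rewrite ltnS => lx.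
case: (pbraid_case x) => [->|[j [x' ex]]]; first by rewrite !str1; lia.
have lx' : (len x = (len x').+1)%N by rewrite ex lenM len_sigma.
rewrite ex reduced_sigma !strM !str_sigma => /andP[rx' cx'].
have [->|ij|ij] := nat_adjP i j; first by move=> _; apply: ldiv_mulr.
- have [e|e] : j = i.+1 \/ i = j.+1 by lia.
  (* Two descents force [x' = sigma i * (sigma i.+1 * w)], and the braid relation brings [sigma i]
     to the front. *)
  + rewrite {}e in cx' *; rewrite swL (@swN i.+1 i); [|lia..] => d.
    have [|//||y ey] := IH i x'; [lia | lia |].
    have ry : reduced y by move: rx'; rewrite ey => /reduced_r.
    move: cx' d; rewrite ey !strM !str_sigma swL swR (@swN i i.+2); [|lia..].
    move=> cx' d; have [|//||w ew] := IH i.+1 y; [|lia|].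
      by move: lx'; rewrite ey lenM len_sigma; lia.
    by exists (sigma i.+1 * (sigma i * w)); rewrite ew sigma_braidA //; lia.
  + rewrite {}e swR (@swN j j.+2); [|lia..] => d.
    have [|//||y ey] := IH j.+1 x'; [lia | lia |].
    have ry : reduced y by move: rx'; rewrite ey => /reduced_r.
    move: cx' d; rewrite ey !strM !str_sigma swL swR (@swN j.+1 j); [|lia..].
    move=> cx' d; have [|//||w ew] := IH j y; [|lia|].
      by move: lx'; rewrite ey lenM len_sigma; lia.
    by exists (sigma j * (sigma j.+1 * w)); rewrite ew sigma_braidA //; lia.
- rewrite !swN; [|lia..] => d.
  have [|//||y ->] := IH i x'; [lia | done |].
  by exists (sigma j * y); apply: sigmaCA (far_sym ij).
Qed.

Lemma str_iota_lt j n k : (k < j)%N -> str (pb (iota j n)) k = k.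
Proof.
elim: n j => [|n IH] j kj; first by rewrite str1.
by rewrite pb_cons strM str_sigma swN; [rewrite IH | |]; lia.
Qed.

Lemma str_iota_start j n : str (pb (iota j n)) j = (j + n)%N.
Proof.
elim: n j => [|n IH] j; first by rewrite str1 addn0.
by rewrite pb_cons strM str_sigma swL IH addnS.
Qed.

Lemma str_iota_mid j n k : (j <= k < j + n)%N -> str (pb (iota j n)) k.+1 = k.
Proof.
elim: n j => [|n IH] j; first by lia.
move=> kj; rewrite pb_cons strM str_sigma.
have [->|ne] := eqVneq k j; first by rewrite swR str_iota_lt.
by rewrite swN; [rewrite IH | |]; lia.
Qed.

Lemma str_Delta m k : (k < m)%N -> str (Delta m) k = (m.-1 - k)%N.
Proof.
elim: m k => // m IH [_|k km]; rewrite DeltaS strM.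
  rewrite str_iota_start add0n subn0.
  by case: m {IH} => [|m]; [exact: str1 | apply: str_low (low_Delta _) _].
by rewrite str_iota_mid ?IH //; lia.
Qed.

(** The ramp is prepended letter by letter. When [sigma j] is added, the strand entering the rest at
    [j.+1] ends at [m], beyond the strand entering at [j], so these two cross for the first time. *)
Lemma reduced_Delta m : reduced (Delta m).
Proof.
elim: m => [|m IH]; first exact: reduced1.
rewrite DeltaS.
suff H n j : (j + n = m)%N -> reduced (pb (iota j n) * Delta m) by apply: H.
elim: n j => [|n IHn] j e; first by rewrite mul1g.
rewrite pb_cons -mulgA reduced_sigma IHn /=; last by lia.
rewrite !strM str_iota_lt // str_iota_start.
rewrite str_Delta; last by lia.
by rewrite addSnnS e; case: m {IH IHn} e => [|m] e;
  [lia | rewrite (str_low (low_Delta _)) //; lia].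
Qed.

Lemma Delta_square_free m a b i : Delta m <> a * (sigma i * (sigma i * b)).
Proof.
move=> e; have := reduced_Delta m; rewrite e => /reduced_r.
by rewrite !reduced_sigma !strM !str_sigma swL swR; lia.
Qed.

(* Delta n = s t; if sigma i does not left divide t, then the strands ending s at
   positions i and i + 1 have not crossed in t, hence have crossed in s. *)
Lemma simple_extend n s i : ldiv s (Delta n) -> (i < n.-1)%N ->
  ~ rdiv (sigma i) s -> ldiv (s * sigma i) (Delta n).
Proof.
case: n => // m; rewrite -[m.+1.-1]/m => -[t et] im nis.
have [d|d] := ltnP (str t i.+1) (str t i).
  have [|u eu] := @reduced_descent i t _ d.
    by have := reduced_Delta m.+1; rewrite et => /reduced_r.
  by exists u; rewrite et eu mulgA.
case: nis; apply/rdiv_rv; rewrite rv_sigma.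
have ls : low m s by have := low_Delta m.+1; rewrite et lowM => /andP[].
apply: reduced_descent.
  by have := reduced_Delta m.+1; rewrite -rv_Delta et rvM => /reduced_r.
have lrs : low m (rv s) by rewrite low_rv.
have bound k : (k <= m)%N -> (str (rv s) k <= m)%N.
  move=> km; rewrite leqNgt; apply/negP => h; have := str_low ls h.
  by rewrite str_rvK => e; move: h; rewrite -e; lia.
(* The half twist reverses positions, so two strands end [t] in the order opposite to the one in
   which they start [s]. *)
have val k : (k <= m)%N -> str t k = (m - str (rv s) k)%N.
  move=> km; have := @str_Delta m.+1 (str (rv s) k).
  rewrite ltnS => /(_ (bound k km)) <-; rewrite et strM.
  by rewrite str_rvK.
have ne : str t i <> str t i.+1 by move/str_inj; lia.
move: d ne; rewrite !val; [|lia..].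
have := bound i; have := bound i.+1; lia.
Qed.

(** Let [g] be the gcd of [y] and [Delta r], and [Delta r = u * g]. If [u] ended with some
    [sigma j], then [g], which starts with every such [sigma j], would make a square appear in
    [Delta r]. *)
Lemma Delta_lcm r y : (forall i, (i < r.-1)%N -> ldiv (sigma i) y) ->
  ldiv (Delta r) y.
Proof.
case: r => [_|r]; first exact: ldiv1.
rewrite -[r.+1.-1]/r => h.
have [g [gy gD gm]] := gcd_exists y (Delta r.+1).
have [u eu] := ldiv_Delta_rdiv gD.
have lu : low r (rv u).
  by have := low_Delta r.+1; rewrite eu lowM low_rv => /andP[].
case: (pbraid_case (rv u)) => [/(congr1 rv)|[j [v ev]]].
  by rewrite rvK rv1 => e; rewrite eu e mul1g.
have jr : (j < r)%N by move: lu; rewrite ev lowM low_sigma => /andP[].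
have [w ew] : ldiv (sigma j) g by apply: gm; [apply: h | apply: sigma_ldiv_Delta].
case: (@Delta_square_free r.+1 (rv v) w j).
by rewrite eu ew -[u]rvK ev rvM rv_sigma !mulgA.
Qed.

Lemma Delta_rlcm r y : (forall i, (i < r.-1)%N -> rdiv (sigma i) y) ->
  rdiv (Delta r) y.
Proof.
move=> h; apply/rdiv_rv; rewrite rv_Delta; apply: Delta_lcm => i ir.
by rewrite -rv_sigma; apply/rdiv_rv/h.
Qed.

(** * Normal sequences *)

Section NormalForm.

Variable n : nat.

Local Notation D := (Delta n).
Local Notation lown := (low n.-1).
Local Notation pr s := (\prod_(x <- s) x).

Lemma low_DeltaX k : lown (D ^+ k).
Proof.
by elim: k => [|k IH]; rewrite ?low1 // expgS lowM low_Delta.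
Qed.

Lemma low_divisor k x : ldiv x (D ^+ k) -> lown x.
Proof. by move/low_ldiv; apply; apply: low_DeltaX. Qed.

Lemma DeltaX_conjl k a : lown a ->
  exists2 b, lown b & a * D ^+ k = D ^+ k * b.
Proof.
elim: k a => [|k IH] a la; first by exists a; rewrite // mul1g mulg1.
have [b lb e] := Delta_conjl la; have [c lc e'] := IH b lb.
by exists c; rewrite // expgS mulgA e -mulgA e' mulgA.
Qed.

Lemma DeltaX_conjr k a : lown a ->
  exists2 b, lown b & D ^+ k * a = b * D ^+ k.
Proof.
elim: k a => [|k IH] a la; first by exists a; rewrite // mul1g mulg1.
have [b lb e] := Delta_conjr la; have [c lc e'] := IH b lb.
by exists c; rewrite // expgSr -mulgA e mulgA e' mulgA.
Qed.

(** With [D = s * t], conjugation by [D ^+ k] moves [t] to the right end of [D ^+ k.+1]. *)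
Lemma simple_mul_DeltaX k s y :
  ldiv s D -> ldiv y (D ^+ k) -> ldiv (s * y) (D ^+ k.+1).
Proof.
move=> sD yD; apply: (@ldiv_trans (s * D ^+ k)); first exact/ldiv_mul2l.
have lD := low_Delta n; case: sD lD => t eD; rewrite [in low _ _]eD lowM.
case/andP=> _ lt; have [t' _ e] := DeltaX_conjl k lt.
by exists t'; rewrite expgS {1}eD -!mulgA e.
Qed.

Lemma prod_simple_DeltaX k (s : seq pbraid) : (forall x, x \in s -> ldiv x D) ->
  (size s <= k)%N -> ldiv (pr s) (D ^+ k).
Proof.
elim: s k => [|a s IH] k hs; first by rewrite big_nil => _; apply: ldiv1.
case: k => // k; rewrite ltnS big_cons => sk; apply: simple_mul_DeltaX.
  by apply: hs; rewrite inE eqxx.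
by apply: IH => // x xs; apply: hs; rewrite inE xs orbT.
Qed.

Lemma low_div_DeltaX x : lown x -> ldiv x (D ^+ len x).
Proof.
move: x; apply: low_ind => [|i x im _ IH]; first exact: ldiv1.
rewrite lenM len_sigma; apply: simple_mul_DeltaX => //.
exact: sigma_ldiv_Delta.
Qed.

(** Gcds are compatible with right multiplication by [D ^+ k]: this power divides the gcd [G] of the
    two products on the left, so [G = q' * D ^+ k], and then [q'] divides [x] and [y]. *)
Lemma lgcd_DeltaX k x y g h : lown x -> lown y -> is_lgcd x y g ->
  ldiv h (x * D ^+ k) -> ldiv h (y * D ^+ k) -> ldiv h (g * D ^+ k).
Proof.
move=> lx ly [gx gy gm].
have [G [Gx Gy Gm]] := gcd_exists (x * D ^+ k) (y * D ^+ k).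
move=> hx hy; apply: ldiv_trans (Gm _ hx hy) _.
have [x' lx' ex] := DeltaX_conjl k lx; have [y' ly' ey] := DeltaX_conjl k ly.
have [q eG] : ldiv (D ^+ k) G.
  by apply: Gm; rewrite ?ex ?ey; apply: ldiv_mulr.
have lq : lown q.
  have := @low_ldiv n.-1 _ _ Gx; rewrite lowM lx low_DeltaX => /(_ isT).
  by rewrite eG lowM => /andP[].
have [q' lq' eq] := DeltaX_conjr k lq.
have q'div z : lown z -> ldiv G (z * D ^+ k) -> ldiv q' z.
  move=> lz [r er]; have : lown (z * D ^+ k) by rewrite lowM lz low_DeltaX.
  rewrite er eG eq => /[dup] e; rewrite lowM => /andP[_ lr].
  have [r' _ er'] := DeltaX_conjr k lr; exists r'.
  by apply: (@mulIp (D ^+ k)); rewrite er eG eq -!mulgA er'.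
have [e ge] := gm q' (q'div x lx Gx) (q'div y ly Gy).
have le : lown e by move: (low_ldiv gx lx); rewrite ge lowM => /andP[].
have [e' _ ee] := DeltaX_conjl k le.
by exists e'; rewrite ge eG eq -!mulgA ee.
Qed.

Lemma normal_cons a s :
  normal n (a :: s) <-> is_lgcd D (a * pr s) a /\ normal n s.
Proof.
split=> [[simp h]|[ha [simp h]]].
  split; first by have := h 0%N isT; rewrite drop0 big_cons.
  split=> [x xs|k ks]; first by apply: simp; rewrite inE xs orbT.
  exact: (h k.+1).
split=> [x|[|k] ks]; last exact: h.
  by rewrite inE => /predU1P[->|/simp //]; case: ha.
by rewrite drop0 big_cons.
Qed.

Lemma normal_nil : normal n [::].
Proof. by []. Qed.

Lemma prod_eq1_nth (s : seq pbraid) k : pr s = 1 -> nth 1 s k = 1.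
Proof.
elim: s k => [|a s IH] k; first by rewrite nth_nil.
by rewrite big_cons => /mulp_eq1[a1 s1]; case: k => [|k] //=; apply: IH.
Qed.

Lemma normal_uniq s t : normal n s -> normal n t -> pr s = pr t ->
  forall k, nth 1 s k = nth 1 t k.
Proof.
elim: s t => [|a s IH] t ns nt e k.
  by rewrite nth_nil prod_eq1_nth // -e big_nil.
case: t nt e => [|b t] nt e; first by rewrite nth_nil prod_eq1_nth // e big_nil.
move: ns nt e => /normal_cons[ha ns] /normal_cons[hb nt]; rewrite !big_cons => e.
rewrite e in ha; have ab := is_lgcd_uniq ha hb.
case: k => [//|k] /=; apply: IH => //.
by apply: (@mulpI a); rewrite e ab.
Qed.

(** Split off [g], the gcd of [D] and [x]. As [x] divides both [D * D ^+ d] and [x * D ^+ d], it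
    divides [g * D ^+ d], so the quotient divides [D ^+ d]. The sequence is padded with [1] to
    length exactly [d]. *)
Lemma normal_exists d x : ldiv x (D ^+ d) ->
  exists s, [/\ normal n s, pr s = x & size s = d].
Proof.
elim: d x => [|d IH] x xD.
  by exists [::]; split => //; rewrite big_nil; case: xD => t /esym/mulp_eq1[->].
have lx := low_divisor xD.
have [g hg] := gcd_exists D x; have [gD [x' ex] gm] := hg.
have [|s [ns es ss]] := IH x'.
  apply/(ldiv_mul2l g); rewrite -ex.
  apply: (lgcd_DeltaX (low_Delta n) lx hg); first by rewrite -expgS.
  exact: ldiv_mulr.
by exists (g :: s); rewrite big_cons es ex /= ss; split=> //;
   apply/normal_cons; rewrite es -ex.
Qed.

Lemma factor_normal s x d : normal n s -> pr s = x -> factor n d x = nth 1 s d.-1.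
Proof.
move=> ns es; apply: xget_unique; first by exists s.
by move=> y [t [nt et ->]]; apply: normal_uniq => //; rewrite et es.
Qed.

Lemma nat_max_le (A : set nat) b d : (forall j, A j -> (j <= b)%N) ->
  (nat_max A <= d)%N <-> forall j, A j -> (j <= d)%N.
Proof.
move=> hb; have [[j Aj]|nA] := pselect (exists j, A j); last first.
  rewrite /nat_max xgetPN; first by split=> // _ j Aj; case: nA; exists j.
  by move=> j [Aj _]; apply: nA; exists j.
pose P j := `[< A j >].
have exP : exists j, P j by exists j; apply/asboolP.
have ubP k : P k -> (k <= b)%N by move=> /asboolP/hb.
have [k /asboolP Ak kmax] := ex_maxnP exP ubP.
have [AM maxM] : A (nat_max A) /\ forall j, A j -> (j <= nat_max A)%N.
  rewrite /nat_max; apply: (@xgetPex _ 0%N [set k | A k /\ _]).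
  by exists k; split=> // i Ai; apply: kmax; apply/asboolP.
by split=> [le i /maxM /leq_trans|]; [apply | apply].
Qed.

Lemma degree_le d x : lown x -> (degree n x <= d)%N <-> ldiv x (D ^+ d).
Proof.
move=> lx; have [s [ns es ss]] := normal_exists (low_div_DeltaX lx).
have fE e : factor n e x = nth 1 s e.-1 by apply: factor_normal.
(* Without such a bound, [nat_max] could return its default value [0]. *)
have bound j : [set e | (1 <= e)%N /\ factor n e x <> 1] j -> (j <= len x)%N.
  move=> [j1]; rewrite fE -ss => nj; rewrite leqNgt; apply/negP => lj.
  by apply: nj; rewrite nth_default // -ltnS prednK.
rewrite (nat_max_le _ bound); split=> [h|xd j [j1]].
  have e1 : pr (drop d s) = 1.
    rewrite big1_seq // => y /andP[_ /(nthP 1)[i lti <-]]; rewrite nth_drop.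
    apply: contrapT => ne; have := h (d + i).+1; rewrite /= fE => /(_ (conj isT ne)).
    by lia.
  rewrite -es -(cat_take_drop d s) big_cat /= e1 mulg1.
  apply: prod_simple_DeltaX => [y ys|]; last by rewrite size_take_min geq_minl.
  by case: ns => simp _; apply: simp; apply: mem_take ys.
have [t [nt et st]] := normal_exists xd.
rewrite (factor_normal _ nt et) => ne; rewrite leqNgt; apply/negP => lj.
by apply: ne; rewrite nth_default // -ltnS prednK // st.
Qed.

(* With H z := gcd (Delta n, z), this is H (a y) = H (a (H y)). *)
Lemma head_mul a y b h : ldiv a D -> is_lgcd D y b ->
  ldiv h D -> ldiv h (a * y) -> ldiv h (a * b).
Proof.
move=> aD [_ _ bm] hD hy.
have [m [[e ->] hm mm]] := lcm_exists (ldiv_mulr a y) hy.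
apply: ldiv_trans hm _; apply/ldiv_mul2l; apply: bm.
  have [q eD] := mm D aD hD; apply: (@ldivW e q); apply: rdiv_Delta_ldiv.
  by exists a; rewrite eD mulgA.
by apply/(ldiv_mul2l a); apply: mm => //; apply: ldiv_mulr.
Qed.

(** Were the gcd larger than [a], some [a * sigma j] would divide both [D] and [a * t]; then
    [sigma j] ends [a], and [D] contains a square. *)
Lemma head_pair a t : ldiv a D -> 
  (forall j, ldiv (sigma j) t -> rdiv (sigma j) a) -> is_lgcd D (a * t) a.
Proof.
move=> aD h; split=> //; first exact: ldiv_mulr.
move=> b bD bt; have [m [am bm mm]] := lcm_exists (ldiv_mulr a t) bt.
have [e em] := am; have [e1|[j [f ef]]] := pbraid_case e.
  by move: bm; rewrite em e1 mulg1.
have [a' ea] : rdiv (sigma j) a.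
  apply: h; apply: (@ldivW _ f); rewrite -ef; apply/(ldiv_mul2l a); rewrite -em.
  by apply: mm => //; apply: ldiv_mulr.
have [q eD] := mm D aD bD.
case: (@Delta_square_free n a' (f * q) j).
by rewrite eD em ea ef -!mulgA.
Qed.

(** Normality is a local condition: by [head_mul], the head of [b * y] depends only on [b] and the
    head of [y], so only the last pair has to be examined. *)
Lemma normal_rcons s a t : normal n (rcons s a) -> ldiv t D ->
  (forall j, ldiv (sigma j) t -> rdiv (sigma j) a) ->
  normal n (rcons (rcons s a) t).
Proof.
move=> + tD h; elim: s => [|b s IH] /=.
  case=> simp _; apply/normal_cons; rewrite big_seq1; split.
    by apply: head_pair h; apply: simp; rewrite inE.
  apply/normal_cons; rewrite big_nil mulg1; split; last exact: normal_nil.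
  by split=> //; apply: ldiv_refl.
move=> /normal_cons[hb ns]; have nst := IH ns; apply/normal_cons; split=> //.
case: (hb) => bD _ bm; split=> // [|c cD cb]; first exact: ldiv_mulr.
have [c' [u [eu gc']]] : exists c' u, rcons s a = c' :: u /\
    is_lgcd D (pr (rcons (rcons s a) t)) c'.
  case: (s) nst => [|c' u] /normal_cons[].
    by exists a, [::]; rewrite big_cons.
  by exists c', (rcons u a); rewrite big_cons.
apply: bm => //; apply: ldiv_trans (head_mul bD gc' cD cb) _.
by rewrite eu big_cons mulgA; apply: ldiv_mulr.
Qed.

Lemma normal_belast s t : normal n (rcons s t) -> normal n s.
Proof.
elim: s => [|b s IH] /=; first by move=> _; apply: normal_nil.
move=> /normal_cons[[bD _ bm] /IH ns]; apply/normal_cons; split=> //.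
split=> // [|h hD hb]; first exact: ldiv_mulr.
apply: bm => //; apply: ldiv_trans hb _.
by rewrite big_rcons /= mulgA; apply: ldiv_mulr.
Qed.

End NormalForm.

(** * Counting *)

Lemma sigma_ldiv_sigma j i : ldiv (sigma j) (sigma i) -> j = i.
Proof.
move=> ji; have e : sigma j = sigma i by apply: ldiv_len_eq; rewrite ?len_sigma.
have := low_sigma j.+1 i; have := low_sigma i.+1 i.
have := low_sigma i.+1 j; have := low_sigma j.+1 j; rewrite e; lia.
Qed.

Lemma finite_low_len m L : finite_set [set x | low m x /\ (len x <= L)%N].
Proof.
elim: L => [|L IH].
  apply: sub_finite_set (finite_set1 (1 : pbraid)) => x [_].
  by rewrite leqn0 => /eqP/len_eq0.
have fin : finite_set ([set (1 : pbraid)] `|`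
    [set sigma i * x | i in `I_m & x in [set x | low m x /\ (len x <= L)%N]]).
  by rewrite finite_setU; split=> //; apply: finite_image2.
apply: sub_finite_set fin => x [].
have [->|[i [y ->]]] := pbraid_case x; first by left.
rewrite lowM low_sigma lenM len_sigma => /andP[im ly] lL.
by right; exists i => //; exists y.
Qed.

Lemma finite_Div z : finite_set (Div z).
Proof.
have [m lz] : exists m, low m z.
  exists (\max_(i <- repr z) i).+1; rewrite -[z]pb_repr low_pb pb_repr.
  by apply/allP => i iz; rewrite ltnS; apply: leq_bigmax_seq.
apply: sub_finite_set (finite_low_len m (len z)) => x xz.
by split; [apply: low_ldiv lz | apply: ldiv_len].
Qed.

Lemma card_fset_set_sub (T : choiceType) (A B : set T) :
  finite_set A -> B `<=` A ->
  #|` fset_set B| = (\sum_(x <- fset_set A | x \in B) 1)%N.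
Proof.
move=> fA BA; have fB := sub_finite_set BA fA.
rewrite card_fset_sum1 [RHS]big_fset_condE; apply: eq_fbigl => x.
rewrite !inE in_fset_set //= andb_idl //.
by rewrite !inE in_fset_set // !inE; apply: BA.
Qed.

(** Double counting of the pairs [(s, x)] with [f x = s]. *)
Lemma sum_card_fibres (T U : choiceType) (f : T -> U) (A : set T) (S : set U) :
  finite_set A -> finite_set S ->
  (\sum_(s <- fset_set S) #|` fset_set [set x | A x /\ f x = s]|)%N =
  #|` fset_set [set x | A x /\ S (f x)]|.
Proof.
move=> fA fS; rewrite (@card_fset_set_sub _ A) //; last by move=> x [].
rewrite [RHS]big_mkcond /=.
transitivity (\sum_(s <- fset_set S) \sum_(x <- fset_set A) (f x == s : nat))%N.
  apply: eq_bigr => s _; rewrite (@card_fset_set_sub _ A) //; last by move=> x [].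
  rewrite big_mkcond /= [LHS]big_seq [RHS]big_seq; apply: eq_bigr => x.
  rewrite in_fset_set // inE => Ax; have [e|ne] := eqVneq (f x) s.
    by rewrite ifT // inE.
  by rewrite ifF //; apply/negP; rewrite inE => -[_ /eqP]; rewrite (negPf ne).
rewrite exchange_big /= [LHS]big_seq [RHS]big_seq; apply: eq_bigr => x.
rewrite in_fset_set // inE => Ax; have [Sx|nSx] := pselect (S (f x)).
  rewrite [RHS]ifT ?inE // (big_fsetD1 (f x)) /= ?eqxx; last first.
    by rewrite in_fset_set // inE.
  by rewrite big_seq big1 // => s; rewrite !inE eq_sym => /andP[/negPf ->].
rewrite [RHS]ifF; last by apply/negP; rewrite inE => -[].
rewrite big_seq big1 // => s; rewrite in_fset_set // inE => Ss.
by case: eqP => // e; case: nSx; rewrite e.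
Qed.

Section Counting.

Variables (n d r : nat).
Hypotheses (d_gt0 : (0 < d)%N) (r_le_n : (r <= n)%N).

Local Notation D := (Delta n).
Local Notation pr s := (\prod_(x <- s) x).

Definition last_rdiv : set pbraid :=
  [set x | ldiv x (D ^+ d) /\ rdiv (Delta r) (factor n d x)].

Lemma normal_exists_rcons k x : ldiv x (D ^+ k.+1) ->
  exists s a, [/\ normal n (rcons s a), pr (rcons s a) = x & size s = k].
Proof.
move=> /normal_exists[s [ns es]]; case/lastP: s ns es => // s a ns es.
by rewrite size_rcons => -[ss]; exists s, a.
Qed.

Lemma normal_simple s a : normal n s -> a \in s -> ldiv a D.
Proof. by case=> h _ /h. Qed.

Lemma Delta_mono : ldiv (Delta r) D.
Proof. by apply: Delta_lcm => i ir; apply: sigma_ldiv_Delta; lia. Qed.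

Lemma rdiv_trans y x z : rdiv x y -> rdiv y z -> rdiv x z.
Proof. by case=> s -> [t ->]; exists (t * s); rewrite mulgA. Qed.

Lemma sigma_ldiv_Delta_inv i k : ldiv (sigma i) (Delta k) -> (i < k.-1)%N.
Proof. by move/low_ldiv => /(_ _ (low_Delta k)); rewrite low_sigma. Qed.

Lemma sigma_rdiv_Delta i k : (i < k.-1)%N -> rdiv (sigma i) (Delta k).
Proof. by move=> /sigma_ldiv_Delta/ldiv_Delta_rdiv. Qed.

(** Let [a] be the last factor. If [sigma i] right divides [a], appending it gives a normal sequence
    of length [d.+1], so the product leaves [Div (D ^+ d)]. Otherwise [a * sigma i] is still simple
    and the product stays there. *)
Lemma last_rdivP x : ldiv x (D ^+ d) ->
  rdiv (Delta r) (factor n d x) <->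
  forall i, (i < r.-1)%N -> ~ ldiv (x * sigma i) (D ^+ d).
Proof.
case: d d_gt0 => // k _ xD.
have [s [a [nsa ex ss]]] := normal_exists_rcons xD.
have aD : ldiv a D by apply: normal_simple nsa _; rewrite mem_rcons inE eqxx.
rewrite (factor_normal _ nsa ex) /= nth_rcons ss ltnn eqxx.
split=> [rda i ir xiD|h].
  have nsai : normal n (rcons (rcons s a) (sigma i)).
    apply: normal_rcons nsa _ _ => [|j ji]; first by apply: sigma_ldiv_Delta; lia.
    rewrite (_ : j = i); first by apply: rdiv_trans rda; apply: sigma_rdiv_Delta.
    exact: sigma_ldiv_sigma ji.
  have [t [nt et st]] := normal_exists xiD.
  (* Entry [k.+1] is [sigma i] in the first sequence, and the default [1] in the second, which has
     only [k.+1] entries. *)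
  have := normal_uniq nsai nt _ k.+1; rewrite big_rcons /= ex et => /(_ erefl).
  rewrite [RHS]nth_default ?st // nth_rcons size_rcons ss ltnn eqxx.
  by move/(congr1 len); rewrite len_sigma len1.
apply: Delta_rlcm => i ir; apply: contrapT => nia; apply: (h i ir).
have aiD : ldiv (a * sigma i) D by apply: simple_extend => //; lia.
rewrite -ex -(_ : pr (rcons s (a * sigma i)) = pr (rcons s a) * sigma i).
  apply: prod_simple_DeltaX; last by rewrite size_rcons ss.
  move=> y; rewrite mem_rcons inE => /predU1P[-> //|ys].
  by apply: normal_simple nsa _; rewrite mem_rcons inE ys orbT.
by rewrite !big_rcons /= mulgA.
Qed.

(** Appending [Delta r] keeps a sequence normal when [Delta r] right divides its last entry;
    conversely, normality of the pair [(a, Delta r)] forces each [sigma i] with [i < r.-1] to end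
    [a]. *)
Lemma factor_Delta_imageE :
  [set y | ldiv y (D ^+ d.+1) /\ factor n d.+1 y = Delta r] =
  [set x * Delta r | x in last_rdiv].
Proof.
rewrite /last_rdiv; case: d d_gt0 => // k _.
rewrite predeqE => y; split=> [[yD fy]|[x [xD rx] <-]].
  have [u [b [nub ey su]]] := normal_exists_rcons yD.
  move: fy; rewrite (factor_normal _ nub ey) /= nth_rcons su ltnn eqxx => eb.
  case/lastP: u => // s a in nub ey su *.
  have ss : size s = k by move: su; rewrite size_rcons => -[].
  have nsa := normal_belast nub.
  have aD : ldiv a D by apply: normal_simple nsa _; rewrite mem_rcons inE eqxx.
  exists (pr (rcons s a)); last by rewrite -ey -eb [in RHS]big_rcons.
  split.
    apply: prod_simple_DeltaX; last by rewrite size_rcons ss.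
    by move=> z zs; apply: normal_simple nsa zs.
  rewrite (factor_normal _ nsa erefl) /= nth_rcons ss ltnn eqxx.
  apply: Delta_rlcm => i ir; apply: contrapT => nia.
  have aiD : ldiv (a * sigma i) D by apply: simple_extend => //; lia.
  (* If [a * sigma i] were simple, it would divide both [D] and [a * Delta r], hence their gcd [a],
     against its length. *)
  case: nub => _ /(_ k); rewrite !size_rcons ss => /(_ (ltnW (ltnSn _))).
  rewrite nth_rcons size_rcons ss ltnSn nth_rcons ss ltnn eqxx.
  rewrite -ss -cats1 -cats1 -catA drop_size_cat // big_cons big_seq1 eb.
  case=> _ _ /(_ _ aiD) am; have ai : ldiv (a * sigma i) (a * Delta r).
    by apply/ldiv_mul2l; apply: sigma_ldiv_Delta.
  by have := ldiv_len (am ai); rewrite lenM len_sigma; lia.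
have [s [a [nsa ex ss]]] := normal_exists_rcons xD.
move: rx; rewrite (factor_normal _ nsa ex) /= nth_rcons ss ltnn eqxx => rda.
have nsad : normal n (rcons (rcons s a) (Delta r)).
  apply: normal_rcons nsa Delta_mono _ => j /sigma_ldiv_Delta_inv jr.
  by apply: rdiv_trans rda; apply: sigma_rdiv_Delta.
have ep : pr (rcons (rcons s a) (Delta r)) = x * Delta r by rewrite big_rcons /= ex.
split; last first.
  by rewrite (factor_normal _ nsad ep) /= nth_rcons size_rcons ss ltnn eqxx.
rewrite -ep; apply: prod_simple_DeltaX; last by rewrite !size_rcons ss.
by move=> z; apply: normal_simple nsad.
Qed.

Lemma card_factorE k s :
  card_factor n k s = #|` fset_set [set x | Div (D ^+ k) x /\ factor n k x = s]|.
Proof.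
rewrite /card_factor; congr (#|` fset_set _|); rewrite predeqE => x; split.
  by case=> /pbraid_nP lx /degree_le xD fx; split=> //; apply: xD.
case=> xD fx; have lx := low_divisor xD.
by split=> //; [apply/pbraid_nP | apply/degree_le].
Qed.

Lemma sum_card_factor :
  (\sum_(s <- fset_set [set s | simple n s /\ rdiv (Delta r) s])
     card_factor n d s)%N = #|` fset_set last_rdiv|.
Proof.
under eq_bigr => s _ do rewrite card_factorE.
rewrite sum_card_fibres; [|exact: finite_Div|]; last first.
  by apply: sub_finite_set (finite_Div D) => s [].
congr (#|` fset_set _|); rewrite predeqE => x; split=> [[xD []]//|[xD rx]].
split=> //; split=> //; have [s [ns es ss]] := normal_exists xD.
rewrite (factor_normal _ ns es).
by apply: normal_simple ns _; apply: mem_nth; rewrite ss prednK.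
Qed.

Lemma card_factor_Delta : card_factor n d.+1 (Delta r) = #|` fset_set last_rdiv|.
Proof.
rewrite card_factorE factor_Delta_imageE fset_set_image; last first.
  by apply: sub_finite_set (finite_Div (D ^+ d)) => x [].
by rewrite card_imfset //= => x y /mulIp.
Qed.

End Counting.

(** * Nontriviality of sigma-positive words *)

Section Dynnikov.

Import Order.TTheory GRing.Theory Num.Theory.
Local Open Scope ring_scope.

Implicit Types p q : rat * rat.

(* Dynnikov's action of sigma_i with max and + replaced by + and times, and with
   the two strands exchanged: the new values at i + 1 and i are
   [dyn1 (s i.+1) (s i)] and [dyn2 (s i.+1) (s i)]; primes are for sigma_i^-1. *)
Definition dyn_aux p q : rat := p.2 * q.1 + p.1 * (1 + p.2) * (1 + q.2).
Definition dyn1 p q : rat * rat :=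
  (p.1 + p.2 * (p.1 + q.1), p.2 * q.1 * q.2 / dyn_aux p q).
Definition dyn2 p q : rat * rat :=
  (p.1 * q.1 * q.2 / (p.1 + q.1 + p.1 * q.2), dyn_aux p q / q.1).

Definition dyn_aux' p q : rat := p.1 * p.2 + q.1 * (1 + p.2) * (1 + q.2).
Definition dyn1' p q : rat * rat :=
  (p.1 * q.1 / (q.1 + p.2 * (p.1 + q.1)), p.1 * p.2 * q.2 / dyn_aux' p q).
Definition dyn2' p q : rat * rat :=
  ((p.1 + q.1 + q.1 * q.2) / q.2, dyn_aux' p q / p.1).

Definition ppos p := (0 < p.1) && (0 < p.2).

Ltac pos := repeat first
  [ assumption | apply: divr_gt0 | apply: mulr_gt0 | apply: addr_gt0
  | exact: ltr01 ].
Ltac posall := repeat match goal with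
  | |- is_true (ppos _) => apply/andP; split; rewrite /= ?/dyn_aux ?/dyn_aux' /=; pos
  | |- is_true (_ && _) => apply/andP; split
  | |- is_true (_ != 0) => apply: lt0r_neq0; pos
  | |- _ /\ _ => split
  end.

Lemma dyn1_pos p q : ppos p -> ppos q -> ppos (dyn1 p q).
Proof. by case/andP=> ? ? /andP[? ?]; posall. Qed.
Lemma dyn2_pos p q : ppos p -> ppos q -> ppos (dyn2 p q).
Proof. by case/andP=> ? ? /andP[? ?]; posall. Qed.
Lemma dyn1'_pos p q : ppos p -> ppos q -> ppos (dyn1' p q).
Proof. by case/andP=> ? ? /andP[? ?]; posall. Qed.
Lemma dyn2'_pos p q : ppos p -> ppos q -> ppos (dyn2' p q).
Proof. by case/andP=> ? ? /andP[? ?]; posall. Qed.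

Ltac dyn_field :=
  rewrite /dyn1 /dyn1' /dyn2 /dyn2' /dyn_aux /dyn_aux' /=;
  congr (_, _); field; posall.

Lemma dyn1K p q : ppos p -> ppos q -> dyn1' (dyn1 p q) (dyn2 p q) = p.
Proof. by case: p q => [? ?] [? ?] /andP[/= ? ?] /andP[/= ? ?]; dyn_field. Qed.

Lemma dyn2K p q : ppos p -> ppos q -> dyn2' (dyn1 p q) (dyn2 p q) = q.
Proof. by case: p q => [? ?] [? ?] /andP[/= ? ?] /andP[/= ? ?]; dyn_field. Qed.

Lemma dyn1'K p q : ppos p -> ppos q -> dyn1 (dyn1' p q) (dyn2' p q) = p.
Proof. by case: p q => [? ?] [? ?] /andP[/= ? ?] /andP[/= ? ?]; dyn_field. Qed.

Lemma dyn2'K p q : ppos p -> ppos q -> dyn2 (dyn1' p q) (dyn2' p q) = q.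
Proof. by case: p q => [? ?] [? ?] /andP[/= ? ?] /andP[/= ? ?]; dyn_field. Qed.

Section Braid.

Variables p q r : rat * rat.
Hypotheses (pp : ppos p) (pq : ppos q) (pr : ppos r).

(** This lemma and the next two are the components, at [i.+2], [i.+1] and [i], of the set-theoretic
    Yang-Baxter equation for the map sending [(p, q)] to [(dyn1 p q, dyn2 p q)]. *)
Lemma dyn_braid1 : dyn1 p (dyn1 q r) = dyn1 (dyn1 p q) (dyn1 (dyn2 p q) r).
Proof.
case: p q r pp pq pr => [? ?] [? ?] [? ?] /andP[/= ? ?] /andP[/= ? ?] /andP[/= ? ?].
by dyn_field.
Qed.

Lemma dyn_braid2 :
  dyn1 (dyn2 p (dyn1 q r)) (dyn2 q r) = dyn2 (dyn1 p q) (dyn1 (dyn2 p q) r).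
Proof.
case: p q r pp pq pr => [? ?] [? ?] [? ?] /andP[/= ? ?] /andP[/= ? ?] /andP[/= ? ?].
by dyn_field.
Qed.

Lemma dyn_braid3 :
  dyn2 (dyn2 p (dyn1 q r)) (dyn2 q r) = dyn2 (dyn2 p q) r.
Proof.
case: p q r pp pq pr => [? ?] [? ?] [? ?] /andP[/= ? ?] /andP[/= ? ?] /andP[/= ? ?].
by dyn_field.
Qed.

End Braid.

Definition coords : Type := nat -> rat * rat.
Implicit Types s : coords.

Definition dyn (l : nat * bool) s : coords := fun k =>
  if k == l.1.+1 then (if l.2 then dyn1 else dyn1') (s l.1.+1) (s l.1)
  else if k == l.1 then (if l.2 then dyn2 else dyn2') (s l.1.+1) (s l.1)
  else s k.

Definition dynw (w : seq (nat * bool)) s : coords := foldr dyn s w.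

Definition cpos s := forall k, ppos (s k).

Lemma dyn_cpos l s : cpos s -> cpos (dyn l s).
Proof.
move=> hs k; rewrite /dyn; case: eqP => _.
  by case: l.2; [apply: dyn1_pos | apply: dyn1'_pos].
by case: eqP => _ //; case: l.2; [apply: dyn2_pos | apply: dyn2'_pos].
Qed.

Lemma dynw_cpos w s : cpos s -> cpos (dynw w s).
Proof. by move=> hs; elim: w => //= l w; apply: dyn_cpos. Qed.

Lemma dynS l s : dyn l s l.1.+1 = (if l.2 then dyn1 else dyn1') (s l.1.+1) (s l.1).
Proof. by rewrite /dyn eqxx. Qed.

Lemma dynL l s : dyn l s l.1 = (if l.2 then dyn2 else dyn2') (s l.1.+1) (s l.1).
Proof. by rewrite /dyn ltn_eqF // eqxx. Qed.

Lemma dynN l s k : k != l.1 -> k != l.1.+1 -> dyn l s k = s k.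
Proof. by rewrite /dyn => /negPf -> /negPf ->. Qed.

Lemma dyn_cancel i b s : cpos s -> dyn (i, b) (dyn (i, ~~ b) s) = s.
Proof.
move=> hs; apply: funext => k.
have [->|k1] := eqVneq k i.+1.
  rewrite (dynS (i, b)) (dynS (i, ~~ b)) (dynL (i, ~~ b)) /=.
  by case: b; rewrite /= ?dyn1K ?dyn1'K.
have [->|k0] := eqVneq k i.
  rewrite (dynL (i, b)) (dynS (i, ~~ b)) (dynL (i, ~~ b)) /=.
  by case: b; rewrite /= ?dyn2K ?dyn2'K.
by rewrite !dynN.
Qed.

Lemma dyn_far i j s : (i.+2 <= j)%N ->
  dyn (i, true) (dyn (j, true) s) = dyn (j, true) (dyn (i, true) s).
Proof.
move=> ij; apply: funext => k.
have lj t l : (l < j)%N -> dyn (j, true) t l = t l.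
  by move=> lj; apply: dynN; rewrite /=; lia.
have li t l : (i.+1 < l)%N -> dyn (i, true) t l = t l.
  by move=> li; apply: dynN; rewrite /=; lia.
have a0 t : dyn (i, true) t i = dyn2 (t i.+1) (t i) := dynL (i, true) t.
have a1 t : dyn (i, true) t i.+1 = dyn1 (t i.+1) (t i) := dynS (i, true) t.
have b1 t : dyn (j, true) t j = dyn2 (t j.+1) (t j) := dynL (j, true) t.
have b2 t : dyn (j, true) t j.+1 = dyn1 (t j.+1) (t j) := dynS (j, true) t.
have [->|k0] := eqVneq k i; first by rewrite a0 !lj ?a0 //; lia.
have [->|k1] := eqVneq k i.+1; first by rewrite a1 !lj ?a1 //; lia.
have [->|k2] := eqVneq k j; first by rewrite b1 !li ?b1 //; lia.
have [->|k3] := eqVneq k j.+1; first by rewrite b2 !li ?b2 //; lia.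
by rewrite !dynN.
Qed.

Lemma dyn_adj i s : cpos s ->
  dyn (i, true) (dyn (i.+1, true) (dyn (i, true) s)) =
  dyn (i.+1, true) (dyn (i, true) (dyn (i.+1, true) s)).
Proof.
move=> hs; apply: funext => k.
have e0 t : dyn (i.+1, true) t i = t i by apply: dynN; rewrite /=; lia.
have e2 t : dyn (i, true) t i.+2 = t i.+2 by apply: dynN; rewrite /=; lia.
have a0 t : dyn (i, true) t i = dyn2 (t i.+1) (t i) := dynL (i, true) t.
have a1 t : dyn (i, true) t i.+1 = dyn1 (t i.+1) (t i) := dynS (i, true) t.
have b1 t : dyn (i.+1, true) t i.+1 = dyn2 (t i.+2) (t i.+1) := dynL (i.+1, true) t.
have b2 t : dyn (i.+1, true) t i.+2 = dyn1 (t i.+2) (t i.+1) := dynS (i.+1, true) t.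
have [->|k0] := eqVneq k i.
  by rewrite ?(e0, e2, a0, a1, b1, b2) dyn_braid3.
have [->|k1] := eqVneq k i.+1.
  by rewrite ?(e0, e2, a0, a1, b1, b2) dyn_braid2.
have [->|k2] := eqVneq k i.+2.
  by rewrite ?(e0, e2, a0, a1, b1, b2) dyn_braid1.
by rewrite !dynN.
Qed.

Lemma pcong_dynw u v : pcong signed_braid_rel u v ->
  forall s, cpos s -> dynw u s = dynw v s.
Proof.
elim=> {u v} [u v []||u v _ h s hs|u v w _ h1 _ h2 s hs|u u' v v' _ h1 _ h2 s hs].
- move=> _ _ [] i j h s hs /=.
    case/orP: h => h; first exact: dyn_far.
    by rewrite (dyn_far _ h).
  by case/orP: h => /eqP ->; rewrite dyn_adj.
- by move=> i b s hs /=; apply: dyn_cancel.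
- by [].
- by rewrite h.
- by rewrite h1 // h2.
- rewrite /dynw !foldr_cat -!/(dynw _ _) h2 //.
  by apply: h1; apply: dynw_cpos.
Qed.

(** Smaller letters do not touch position [m.+1], whereas [(m, true)] adds the positive quantity
    [p.2 * (p.1 + q.1)] to its first coordinate. The equality clause records which case occurs. *)
Lemma dyn_incr m (l : nat * bool) s : cpos s -> (l.1 < m)%N || (l == (m, true)) ->
  (s m.+1).1 <= (dyn l s m.+1).1 ?= iff (l.1 < m)%N.
Proof.
move=> hs; have [lm _|_ /eqP ->] := ltnP l.1 m => /=.
  rewrite dynN; first exact/leif_refl.
    by rewrite gtn_eqF //; apply: leqW.
  by rewrite eqSS gtn_eqF.
have /= -> := dynS (m, true) s; apply/leifP.
by case/andP: (hs m) => ? ?; case/andP: (hs m.+1) => ? ?; rewrite ltrDl; pos.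
Qed.

Lemma dynw_incr m (w : seq (nat * bool)) s : cpos s ->
  all (fun l => (l.1 < m)%N || (l == (m, true))) w ->
  (s m.+1).1 <= (dynw w s m.+1).1 ?= iff all (fun l => (l.1 < m)%N) w.
Proof.
move=> hs; elim: w => [|l w IH] /=; first by move=> _; apply/leif_refl.
move=> /andP[hl hw]; rewrite andbC; apply: leif_trans (IH hw) _.
by apply: dyn_incr => //; apply: dynw_cpos.
Qed.

End Dynnikov.

Lemma main_letter_ge w l : l \in w -> (l.1 <= main_letter w)%N.
Proof. by move=> lw; apply: (leq_bigmax_seq (F := fun a => a.1)). Qed.

Lemma sigma_positive_neq1 w : sigma_positive w -> ~ pcong signed_braid_rel w [::].
Proof.
case/andP=> pw nw /pcong_dynw e.
pose s0 : coords := fun=> (1%R, 1%R).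
have s0pos : cpos s0 by [].
have h : all (fun l => (l.1 < main_letter w)%N || (l == (main_letter w, true))) w.
  apply/allP => -[i b] lw /=; have := main_letter_ge lw; rewrite leq_eqVlt /=.
  case/orP=> [/eqP ei|-> //]; apply/orP; right; rewrite ei in lw *.
  by case: b lw => // lw; rewrite lw in nw.
(* A trivial [w] fixes [s0]; equality then excludes the main letter from [w]. *)
have := dynw_incr s0pos h; rewrite (e _ s0pos) => -[_ /esym].
by rewrite eqxx => /allP/(_ _ pw); rewrite ltnn.
Qed.

(** * Comparability inside Div z *)

Lemma low0_eq1 x : low 0 x -> x = 1.
Proof. by move: x; apply: low_ind. Qed.

(** * Positivity in the braid group *)

Definition low_braid (m : nat) (g : braid) : Prop :=
  exists2 w : seq (nat * bool), all (fun l => l.1 < m)%N w & \pi_braid w = g.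

(** Naming the main index, instead of reading it off the word, makes stability under products
    immediate. *)
Definition main_positive (m : nat) (g : braid) : Prop :=
  exists w : seq (nat * bool),
    [/\ all (fun l => (l.1 < m)%N || (l == (m, true))) w, (m, true) \in w
      & \pi_braid w = g].

Lemma braid_pi_cat (u v : seq (nat * bool)) :
  \pi_braid (u ++ v) = (\pi_braid u : braid) * \pi_braid v.
Proof. by rewrite [RHS]presented_mulE. Qed.

Lemma braid_pi_winv (w : seq (nat * bool)) :
  \pi_braid (winv w) = (\pi_braid w : braid)^-1.
Proof.
apply: (@mulIg braid (\pi_braid w)); rewrite mulVg -braid_pi_cat.
by apply/presentedP; apply: winv_mul.
Qed.

Lemma low_braidM m g h : low_braid m g -> low_braid m h -> low_braid m (g * h).
Proof.
case=> u lu <- [v lv <-]; exists (u ++ v); last exact: braid_pi_cat.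
by rewrite all_cat lu lv.
Qed.

Lemma low_braidV m g : low_braid m g -> low_braid m g^-1.
Proof.
case=> u lu <-; exists (winv u); last exact: braid_pi_winv.
by rewrite /winv all_rev all_map.
Qed.

Lemma low_braid_of_pos m x : low m x -> low_braid m (braid_of_pos x).
Proof.
move=> lx; exists [seq pos_letter i | i <- repr x]; last by [].
by rewrite all_map.
Qed.

Lemma main_positiveM m g h :
  main_positive m g -> main_positive m h -> main_positive m (g * h).
Proof.
case=> u [lu mu <-] [v [lv _ <-]]; exists (u ++ v).
by rewrite all_cat mem_cat lu lv mu; split=> //; apply: braid_pi_cat.
Qed.

Lemma main_positive_lowr m g h :
  main_positive m g -> low_braid m h -> main_positive m (g * h).
Proof.
case=> u [lu mu <-] [v lv <-]; exists (u ++ v).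
rewrite all_cat mem_cat lu mu; split=> //; last exact: braid_pi_cat.
by apply: sub_all lv => l ->.
Qed.

Lemma main_positive_lowl m g h :
  low_braid m g -> main_positive m h -> main_positive m (g * h).
Proof.
case=> u lu <- [v [lv mv <-]]; exists (u ++ v).
rewrite all_cat mem_cat lv mv orbT andbT; split=> //; last exact: braid_pi_cat.
by apply: sub_all lu => l ->.
Qed.

Lemma main_positive_low m k g : (m < k)%N -> main_positive m g -> low_braid k g.
Proof.
move=> mk [w [lw _ <-]]; exists w => //; apply: sub_all lw => l.
by case/orP=> [/ltn_trans|/eqP ->]; first apply.
Qed.

Lemma main_positive_sigma m : main_positive m (braid_of_pos (sigma m)).
Proof.
exists [:: (m, true)]; rewrite /= inE eqxx orbT; split=> //.
by rewrite braid_of_posE.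
Qed.

Lemma main_positive_word m (w : seq (nat * bool)) :
  all (fun l => (l.1 < m)%N || (l == (m, true))) w -> (m, true) \in w ->
  main_letter w = m /\ sigma_positive w.
Proof.
move=> lw mw; have e : main_letter w = m.
  apply/eqP; rewrite eqn_leq (main_letter_ge mw) andbT.
  apply/bigmax_leqP_seq => l /(allP lw) /orP[/ltnW //|/eqP ->] _.
  exact: leqnn.
split=> //; rewrite /sigma_positive e mw; apply/negP => /(allP lw) /=.
by rewrite ltnn => /eqP[].
Qed.

Lemma main_positive_neq1 m g : main_positive m g -> g <> 1.
Proof.
case=> w [lw mw <-]; have [_ /sigma_positive_neq1 h] := main_positive_word lw mw.
by move=> /presentedP.
Qed.

Lemma sigma_positive_main (w : seq (nat * bool)) :
  sigma_positive w -> main_positive (main_letter w) (\pi_braid w).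
Proof.
case/andP=> pw nw; exists w; split=> //.
apply/allP => -[i b] lw; have := main_letter_ge lw; rewrite leq_eqVlt.
case/orP=> [/eqP /= ei|-> //]; apply/orP; right; move: lw; rewrite ei.
by case: b => // lw; rewrite lw in nw.
Qed.

Lemma lt_braidP r x y : lt_braid r x y <->
  exists m, (r <= m.+1)%N /\ main_positive m ((braid_of_pos x)^-1 * braid_of_pos y).
Proof.
split=> [/asboolP[w [pw rw <-]]|[m [rm [w [lw mw ew]]]]].
  by exists (main_letter w); split=> //; apply: sigma_positive_main.
have [em pw] := main_positive_word lw mw.
by apply/asboolP; exists w; rewrite em.
Qed.

Lemma lt_braid_trans r : transitive (lt_braid r).
Proof.
move=> y x z /lt_braidP[m [rm sm]] /lt_braidP[k [rk sk]]; apply/lt_braidP.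
have -> : (braid_of_pos x)^-1 * braid_of_pos z =
    (braid_of_pos x)^-1 * braid_of_pos y * ((braid_of_pos y)^-1 * braid_of_pos z).
  by rewrite -mulgA mulVKg.
have [mk|km|e] := ltngtP m k.
- by exists k; split=> //; apply: main_positive_lowl sk; apply: main_positive_low sm.
- by exists m; split=> //; apply: main_positive_lowr sm _; apply: main_positive_low sk.
- by exists m; split=> //; apply: main_positiveM sm _; rewrite e.
Qed.

(** Comparable elements lie in different cosets of the braid group on [r] strands: otherwise a
    positive element times an element of that group would be trivial. *)
Lemma lt_braid_not_low r x y a b : (0 < r)%N -> lt_braid r x y ->
  low r.-1 a -> low r.-1 b -> x * a <> y * b.
Proof.
move=> r0 /lt_braidP[m [rm sm]] la lb e.
have rm' : (r.-1 <= m)%N by lia.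
have := main_positive_lowr (main_positive_lowr sm (low_braid_of_pos (lowW rm' lb)))
  (low_braidV (low_braid_of_pos (lowW rm' la))).
move/main_positive_neq1; apply; rewrite -mulgA -mulgA.
by rewrite [X in _ * X]mulgA -gmulfM -e gmulfM mulgK mulVg.
Qed.

(** * The graph of cosets that meet the divisors of [z] *)

Section Walk.

Variables (m : nat) (z : pbraid).

(* In Div z, [low_cong] is congruence modulo B_(m+1), and [step] leads from one
   class to another one by a single sigma_(m+1). *)
Definition low_cong (x y : pbraid) : Prop :=
  exists a b, [/\ low m a, low m b, x * a = y * b & ldiv (x * a) z].

Definition step (x y : pbraid) : Prop :=
  exists x', [/\ low_cong x x', ldiv (x' * sigma m) z & low_cong (x' * sigma m) y].

Inductive walk (x : pbraid) : pbraid -> Prop :=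
| walk1 y : step x y -> walk x y
| walkS y w : walk x y -> step y w -> walk x w.

Lemma low_cong_refl x : ldiv x z -> low_cong x x.
Proof. by move=> xz; exists 1, 1; rewrite mulg1 low1. Qed.

Lemma low_cong_sym x y : low_cong x y -> low_cong y x.
Proof. by case=> a [b [la lb e h]]; exists b, a; rewrite -e. Qed.

(** The multiples [y * b] and [y * c] both divide [z], so [y] times the lcm of [b] and [c] does too,
    and this lcm uses only the letters allowed. *)
Lemma low_cong_trans y x w : low_cong x y -> low_cong y w -> low_cong x w.
Proof.
case=> a [b [la lb eab xz]] [c [d [lc ld ecd yz]]].
rewrite eab in xz; case: (xz) => z' ez.
have bz : ldiv b (b * z') by apply: ldiv_mulr.
have cz : ldiv c (b * z').
  by apply/(ldiv_mul2l y); rewrite mulgA -ez.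
have [n [[b' eb] [c' ec] nm] ln] := lcm_exists_low bz cz.
have := ln m lb lc; rewrite eb lowM => /andP[_ lb'].
have := ln m lb lc; rewrite ec lowM => /andP[_ lc'].
exists (a * b'), (d * c'); rewrite !lowM la lb' ld lc'; split=> //.
  by rewrite !mulgA eab -ecd -!mulgA -eb ec.
by rewrite mulgA eab -mulgA -eb ez -mulgA; apply/ldiv_mul2l/nm.
Qed.

Lemma low_cong_ldivl x y : low_cong x y -> ldiv x z.
Proof. by case=> a [b [_ _ _ /ldivW]]. Qed.

Lemma low_cong_ldivr x y : low_cong x y -> ldiv y z.
Proof. by move/low_cong_sym/low_cong_ldivl. Qed.

(** From [x * a = y * b], the left lcm of [a] and [b] provides [c]. Questions about two congruent
    elements thus move to [Div c], where [c] has smaller letters. *)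
Lemma low_cong_interval x y : low_cong x y -> exists g e f c,
  [/\ x = g * e, y = g * f, low m c, ldiv e c /\ ldiv f c & ldiv (g * c) z].
Proof.
case=> a [b [la lb e xz]].
have [c [u [v [lc ecu ecv [g eg]]]]] := rlcm_exists_low la lb erefl e.
exists g, u, v, c; split=> //.
- by apply: (@mulIp a); rewrite eg ecu mulgA.
- by apply: (@mulIp b); rewrite -e eg ecv mulgA.
- by split; [rewrite ecu | rewrite ecv]; apply: ldiv_mulr.
- by rewrite -eg.
Qed.

Lemma step_congl x y w : low_cong x y -> step y w -> step x w.
Proof.
by move=> xy [x' [yx' x'z h]]; exists x'; split=> //; apply: low_cong_trans yx'.
Qed.

Lemma step_congr x y w : step x y -> low_cong y w -> step x w.
Proof.
by move=> [x' [xx' x'z h]] yw; exists x'; split=> //; apply: low_cong_trans yw.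
Qed.

Lemma walk_congl x y w : low_cong x y -> walk y w -> walk x w.
Proof.
move=> xy; elim=> [{}w yw|v {}w _ IH vw]; first exact/walk1/(step_congl xy).
exact: walkS IH vw.
Qed.

Lemma walk_congr x y w : walk x y -> low_cong y w -> walk x w.
Proof.
case=> [{}y xy|v {}y xv vy] yw; first exact/walk1/(step_congr xy).
exact: walkS xv (step_congr vy yw).
Qed.

Lemma walk_trans x y w : walk x y -> walk y w -> walk x w.
Proof.
by move=> xy; elim=> [{}w|v {}w _ xv vw]; [apply: walkS | apply: walkS xv vw].
Qed.

Lemma low_cong_low_braid x y : low_cong x y ->
  low_braid m ((braid_of_pos x)^-1 * braid_of_pos y).
Proof.
case=> a [b [la lb e _]].
have -> : (braid_of_pos x)^-1 * braid_of_pos y =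
    braid_of_pos a * (braid_of_pos b)^-1.
  apply: (@mulIg _ (braid_of_pos b)); rewrite mulgVK -mulgA -gmulfM -e gmulfM.
  exact: mulKg.
by apply: low_braidM; [apply: low_braid_of_pos | apply/low_braidV/low_braid_of_pos].
Qed.

Lemma braid_telescope (x y w : braid) : x^-1 * w = x^-1 * y * (y^-1 * w).
Proof. by rewrite -mulgA mulVKg. Qed.

Lemma step_main_positive x y : step x y ->
  main_positive m ((braid_of_pos x)^-1 * braid_of_pos y).
Proof.
case=> x' [/low_cong_low_braid h1 _ /low_cong_low_braid h2].
rewrite (braid_telescope _ (braid_of_pos x')); apply: main_positive_lowl h1 _.
rewrite (braid_telescope _ (braid_of_pos (x' * sigma m))).
by apply: main_positive_lowr h2; rewrite gmulfM mulKg; apply: main_positive_sigma.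
Qed.

Lemma walk_main_positive x y : walk x y ->
  main_positive m ((braid_of_pos x)^-1 * braid_of_pos y).
Proof.
elim=> [{}y /step_main_positive //|v {}y _ h /step_main_positive h'].
by rewrite (braid_telescope _ (braid_of_pos v)); apply: main_positiveM.
Qed.

Lemma walk_irrefl x : ~ walk x x.
Proof. by move/walk_main_positive/main_positive_neq1; rewrite mulVg. Qed.

Lemma walk_last x y : walk x y -> exists2 v, low_cong x v \/ walk x v & step v y.
Proof.
case=> [{}y xy|v {}y xv vy]; last by exists v => //; right.
by exists x => //; left; apply: low_cong_refl; case: xy => v [/low_cong_ldivl].
Qed.

Definition linked x y : Prop := [\/ low_cong x y, walk x y | walk y x].

Hypothesis step_pred : forall x y w, step x w -> step y w -> linked x y.

(** Induction on the number of elements leading to [w]: the last steps of two walks leave from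
    linked vertices, so both walks can be redirected to a common vertex strictly below [w]. *)
Lemma walk_down_linked w : forall x y,
  low_cong x w \/ walk x w -> low_cong y w \/ walk y w -> linked x y.
Proof.
pose below v := fset_set [set u | Div z u /\ walk u v].
have fin v : finite_set [set u | Div z u /\ walk u v].
  by apply: sub_finite_set (finite_Div z) => u [].
have [L] := ubnP #|` below w|; elim: L => // L IH in w *; rewrite ltnS => lw x y.
case=> [xw|xw] [yw|yw].
- by apply: Or31; apply: low_cong_trans xw _; apply: low_cong_sym.
- by apply: Or33; apply: walk_congr yw _; apply: low_cong_sym.
- by apply: Or32; apply: walk_congr xw _; apply: low_cong_sym.
(* The inclusion is strict because [v] leads to [w] but, by acyclicity, not to itself. *)
have lt_below v : step v w -> (#|` below v| < L)%N.
  move=> vw; apply: leq_trans lw; apply: fproper_ltn_card.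
  rewrite fproperE; apply/andP; split.
    apply/fsubsetP => u; rewrite !in_fset_set // !inE => -[uz uv].
    by split=> //; apply: walkS uv vw.
  apply/fsubsetPn; exists v; rewrite in_fset_set //.
    by rewrite inE; split; [case: vw => v' [/low_cong_ldivl] | apply: walk1].
  by apply/negP; rewrite inE => -[_ /walk_irrefl].
have [v xv vw] := walk_last xw; have [u yu uw] := walk_last yw.
case: (step_pred vw uw) => vu.
- apply: (IH u (lt_below u uw)) => //.
  case: xv => [xv|xv]; first by left; apply: low_cong_trans vu.
  by right; apply: walk_congr vu.
- apply: (IH u (lt_below u uw)) => //; right.
  by case: xv => [xv|xv]; [apply: walk_congl vu | apply: walk_trans vu].
- apply: (IH v (lt_below v vw)) => //; right.
  by case: yu => [yu|yu]; [apply: walk_congl vu | apply: walk_trans vu].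
Qed.

(** Read the quotient [t] letter by letter: a letter [m] is a step, a smaller one stays in the
    coset. *)
Lemma to_top t : low m.+1 t -> forall x, x * t = z -> low_cong x z \/ walk x z.
Proof.
move: t; apply: low_ind => [x|i t im lt IH x ez].
  by rewrite mulg1 => ->; left; apply: low_cong_refl; apply: ldiv_refl.
have xz : ldiv x z by rewrite -ez; apply: ldiv_mulr.
have xiz : ldiv (x * sigma i) z by rewrite -ez mulgA; apply: ldiv_mulr.
rewrite mulgA in ez; move: im; rewrite ltnS leq_eqVlt => /orP[/eqP ei|im].
  rewrite ei in xiz ez.
  have s : step x (x * sigma m) by exists x; split=> //; apply: low_cong_refl.
  right; case: (IH _ ez) => h; first exact/walk1/(step_congr s).
  exact: walk_trans (walk1 s) h.
have h : low_cong x (x * sigma i).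
  by exists (sigma i), 1; rewrite mulg1 low1 low_sigma.
by case: (IH _ ez) => h'; [left; apply: low_cong_trans h' | right; apply: walk_congl h'].
Qed.

Lemma Div_linked x y : low m.+1 z -> ldiv x z -> ldiv y z -> linked x y.
Proof.
move=> lz [t et] [u eu]; apply: (walk_down_linked (w := z)).
  by apply: (@to_top t) => //; move: lz; rewrite et lowM => /andP[].
by apply: (@to_top u) => //; move: lz; rewrite eu lowM => /andP[].
Qed.

End Walk.

Lemma low_congW m k z x y : (m <= k)%N -> low_cong m z x y -> low_cong k z x y.
Proof.
by move=> mk [a [b [la lb e h]]]; exists a, b; split=> //; apply: lowW mk _.
Qed.

Lemma mul_low_far m a u v : low m a -> u * a = v * sigma m.+1 ->
  exists u', u = u' * sigma m.+1.
Proof.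
move=> la; move: a la u v; apply: low_ind_r => [u v|i a im _ IH u v].
  by rewrite mulg1 => ->; exists v.
rewrite mulgA => /mirror_far[|c [e _]]; first by lia.
exact: IH e.
Qed.

Section Lift.

Variables (m : nat) (c g z : pbraid).
Hypothesis gcz : ldiv (g * c) z.

(* A path in g Div(c), c in B_(m+1)^+, that ends at a right multiple of
   sigma_(m+2) has all its vertices right divisible by sigma_(m+2), and removing
   this factor turns its sigma_(m+1)-steps into sigma_(m+2)-steps. *)
Lemma lift_cong y f f1 : low_cong m c y f -> g * f = f1 * sigma m.+1 ->
  exists2 y1, g * y = y1 * sigma m.+1 & low_cong m z y1 f1.
Proof.
case=> a [b [la lb e yc]] ef.
have eb : f1 * sigma m.+1 * b = f1 * b * sigma m.+1.
  by rewrite -!mulgA (low_sigmaC lb).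
have ey : g * y * a = f1 * b * sigma m.+1 by rewrite -mulgA e mulgA ef eb.
have [y1 ey1] := mul_low_far la ey; exists y1 => //.
have ea : g * y * a = y1 * a * sigma m.+1.
  by rewrite ey1 -!mulgA (low_sigmaC la).
exists a, b; split=> //; first by apply: (@mulIp (sigma m.+1)); rewrite -ea.
apply: (@ldivW _ (sigma m.+1)); rewrite -ea -mulgA.
by apply: ldiv_trans gcz; apply/ldiv_mul2l.
Qed.

Lemma lift_step y f f1 : step m c y f -> g * f = f1 * sigma m.+1 ->
  exists2 y1, g * y = y1 * sigma m.+1 & step m.+1 z y1 f1.
Proof.
case=> x' [yx' xc xf] ef.
have [y2 ey2 y2f1] := lift_cong xf ef.
(* The braid relation gives [g * x' = q * sigma m * sigma m.+1] and
   [y2 = q * sigma m.+1 * sigma m]. *)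
rewrite mulgA in ey2; have [|q [ex' ey2']] := mirror_adj _ ey2; first by lia.
have [y1 ey1 y1q] := lift_cong yx' ex'; exists y1 => //.
have y2z : ldiv y2 z := low_cong_ldivl y2f1.
have qz : ldiv (q * sigma m) z := low_cong_ldivr y1q.
(* One level up [sigma m] is absorbed by the congruence, so [q] represents the class of [y1] and
   [q * sigma m.+1] that of [f1]. *)
rewrite ey2' in y2z y2f1; exists q; split.
- apply: (@low_cong_trans _ _ (q * sigma m)); first exact: low_congW y1q.
  by exists 1, (sigma m); rewrite mulg1 low1 low_sigma.
- exact: ldivW y2z.
- apply: (@low_cong_trans _ _ (q * sigma m.+1 * sigma m)); last exact: low_congW y2f1.
  by exists (sigma m), 1; rewrite mulg1 low1 low_sigma.
Qed.

Lemma lift_walk y f : walk m c y f -> forall f1, g * f = f1 * sigma m.+1 ->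
  exists2 y1, g * y = y1 * sigma m.+1 & walk m.+1 z y1 f1.
Proof.
elim=> [{}f yf f1 ef|v {}f _ IH vf f1 ef].
  by have [y1 e s] := lift_step yf ef; exists y1 => //; apply: walk1.
have [v1 ev s] := lift_step vf ef; have [y1 ey h] := IH v1 ev.
by exists y1 => //; apply: walkS h s.
Qed.

End Lift.

Lemma linked_congl m z x x' y : low_cong m z x x' -> linked m z x' y ->
  linked m z x y.
Proof.
move=> xx' [h|h|h]; first exact/Or31/(low_cong_trans xx').
  exact/Or32/(walk_congl xx').
by apply/Or33/(walk_congr h); apply: low_cong_sym.
Qed.

Lemma linked_sym m z x y : linked m z x y -> linked m z y x.
Proof. by case=> h; [apply/Or31/low_cong_sym | apply: Or33 | apply: Or32]. Qed.

(** Induction on [m] supplies the premise of [Div_linked]. If [x1] and [y1] step to one coset,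
    [x1 * sigma m] and [y1 * sigma m] lie in an interval [g * Div c]; comparability in [Div c] lifts
    to [x1] and [y1]. *)
Lemma Div_trichotomy m z x y : low m.+1 z -> ldiv x z -> ldiv y z ->
  linked m z x y.
Proof.
elim: m z x y => [|m IH] z x y lz xz yz; apply: Div_linked => //.
all: move=> {xz yz}x {}y w [x1 [xx1 x1z x1w]] [y1 [yy1 y1z y1w]].
all: apply: linked_congl xx1 _; apply/linked_sym; 
     apply: linked_congl yy1 _; apply/linked_sym.
all: have [g [e [f [c [ee ef lc [ec fc] gcz]]]]] :=
       @low_cong_interval _ z _ _ (low_cong_trans x1w (low_cong_sym y1w)).
  (* At the bottom level there are no smaller letters, so the interval is a single point. *)
  have e1 := low0_eq1 lc; rewrite e1 in ec fc.
  have [t /esym/mulp_eq1[e1' _]] := ec; have [u /esym/mulp_eq1[f1' _]] := fc.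
  have -> : x1 = y1 by apply: (@mulIp (sigma 0)); rewrite ee ef e1' f1'.
  by apply: Or31; apply: low_cong_refl; apply: ldivW y1z.
case: (IH c e f lc ec fc) => h.
- have [x2 ex2 h2] := lift_cong gcz h (esym ef).
  have -> : x1 = x2 by apply: (@mulIp (sigma m.+1)); rewrite ee.
  by apply: Or31; apply: low_congW h2.
- have [x2 ex2 h2] := lift_walk gcz h (esym ef).
  have -> : x1 = x2 by apply: (@mulIp (sigma m.+1)); rewrite ee.
  exact: Or32.
- have [y2 ey2 h2] := lift_walk gcz h (esym ee).
  have -> : y1 = y2 by apply: (@mulIp (sigma m.+1)); rewrite ef.
  exact: Or33.
Qed.

(** Either [Div_trichotomy] decides at the top index, or [x] and [y] lie in an interval [g * Div c]
    one level lower, and the left factor [g] does not affect the order. At [k = 0] a single coset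
    remains. *)
Lemma lt_braid_total r k z x y : low (r.-1 + k) z -> ldiv x z -> ldiv y z ->
  [\/ low_cong r.-1 z x y, lt_braid r x y | lt_braid r y x].
Proof.
elim: k z x y => [|k IH] z x y.
  rewrite addn0 => lz [a ea] [b eb]; apply: Or31; exists a, b.
  rewrite -ea -eb; split=> //; last exact: ldiv_refl.
    by move: lz; rewrite ea lowM => /andP[].
  by move: lz; rewrite eb lowM => /andP[].
rewrite addnS => lz xz yz.
have lt u v : walk (r.-1 + k) z u v -> lt_braid r u v.
  by move=> /walk_main_positive h; apply/lt_braidP; exists (r.-1 + k)%N; split=> //; lia.
case: (Div_trichotomy lz xz yz) => [h|/lt h|/lt h]; [|exact: Or32|exact: Or33].
have [g [e [f [c [-> -> lc [ec fc] gcz]]]]] := low_cong_interval h.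
have tr u v : lt_braid r u v -> lt_braid r (g * u) (g * v).
  move=> /lt_braidP[j [rj s]]; apply/lt_braidP; exists j; split=> //.
  by rewrite !gmulfM invgM -mulgA mulKg.
case: (IH c e f lc ec fc) => [[a [b [la lb eab ac]]]|/tr h'|/tr h'].
- apply: Or31; exists a, b; rewrite -!mulgA eab; split=> //.
  by apply: ldiv_trans gcz; apply/ldiv_mul2l; rewrite -eab.
- exact: Or32.
- exact: Or33.
Qed.

(** * Heights *)

Lemma nat_max_eq (A : set nat) N :
  A N -> (forall j, A j -> (j <= N)%N) -> nat_max A = N.
Proof.
move=> AN maxN; apply: xget_unique => // k [Ak maxk].
by apply/eqP; rewrite eqn_leq maxN // maxk.
Qed.

Section Height.

Variables (n d r : nat).
Hypotheses (d_gt0 : (0 < d)%N) (r_gt0 : (0 < r)%N) (r_le_n : (r <= n)%N).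

Local Notation z := (Delta n ^+ d).
Local Notation M := (last_rdiv n d r).

Lemma finite_last_rdiv : finite_set M.
Proof. by apply: sub_finite_set (finite_Div z) => x []. Qed.

(** Multiply by letters below [r.-1] as long as the result divides [z]; lengths are bounded, and
    [last_rdivP] recognises the end. *)
Lemma last_rdiv_above x : ldiv x z -> exists2 a, low r.-1 a & M (x * a).
Proof.
have [L] := ubnP (len z - len x); elim: L => // L IH in x *; rewrite ltnS => lx xz.
have [[i ir xiz]|h] := pselect (exists2 i, (i < r.-1)%N & ldiv (x * sigma i) z).
  have [|a la Ma] := IH (x * sigma i) _ xiz.
    by have := ldiv_len xiz; move: lx; rewrite lenM len_sigma; lia.
  by exists (sigma i * a); rewrite ?lowM ?low_sigma ?ir // mulgA.
exists 1; rewrite ?low1 // mulg1; split=> //.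
by apply/(last_rdivP d_gt0 r_le_n xz) => i ir xiz; apply: h; exists i.
Qed.

Lemma last_rdiv_low_eq1 x a : M x -> low r.-1 a -> ldiv (x * a) z -> a = 1.
Proof.
move=> [xz /(last_rdivP d_gt0 r_le_n xz) h] la xaz.
have [//|[i [a' ea]]] := pbraid_case a.
case: (h i); first by move: la; rewrite ea lowM low_sigma => /andP[].
by apply: (@ldivW _ a'); rewrite -mulgA -ea.
Qed.

Lemma last_rdiv_total x y : M x -> M y ->
  [\/ x = y, lt_braid r x y | lt_braid r y x].
Proof.
move=> Mx My; have lz : low (r.-1 + (n - r)) z.
  by apply: lowW (low_DeltaX n d); lia.
case: (lt_braid_total lz Mx.1 My.1) => h; [|exact: Or32|exact: Or33].
case: h => a [b [la lb e xaz]]; apply: Or31.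
have a1 := last_rdiv_low_eq1 Mx la xaz.
have b1 : b = 1 by apply: last_rdiv_low_eq1 My lb _; rewrite -e.
by move: e; rewrite a1 b1 !mulg1.
Qed.

Lemma chain_size c : sorted (lt_braid r) c -> (forall x, x \in c -> Div z x) ->
  (size c <= #|` fset_set M|)%N.
Proof.
move=> sc cz.
(* Outside [Div z] the value is a dummy, so that [choice] yields a total function. *)
have above x : exists y, Div z x -> exists2 a, low r.-1 a & y = x * a /\ M y.
  have [xz|nxz] := pselect (Div z x); last by exists x.
  by have [a la Ma] := last_rdiv_above xz; exists (x * a) => _; exists a.
have [mu hmu] := choice above.
rewrite -(size_map mu); apply: uniq_leq_size => [|y /mapP[x xc ->]]; last first.
  rewrite in_fset_set; last exact: finite_last_rdiv.
  by have [a _ []] := hmu x (cz x xc); rewrite inE.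
rewrite uniq_pairwise pairwise_map.
move: sc; rewrite sorted_pairwise; last exact: lt_braid_trans.
apply: (@sub_in_pairwise _ (mem c)); last exact/allP.
move=> x y xc yc ltxy; apply/eqP => /= e.
have [a la [ea _]] := hmu x (cz x xc); have [b lb [eb _]] := hmu y (cz y yc).
by apply: (lt_braid_not_low r_gt0 ltxy la lb); rewrite -ea -eb.
Qed.

Lemma height_card : height r z = #|` fset_set M|.
Proof.
apply: nat_max_eq => [|k [c [<- sc cz]]]; last exact: chain_size.
have memM x : x \in fset_set M -> M x.
  by rewrite in_fset_set ?inE //; apply: finite_last_rdiv.
(* Sorting uses the reflexive closure, total on [M]; since the sorted list has no repetition, it is
   strictly increasing. *)
pose le x y := (x == y) || lt_braid r x y.
have le_total : {in mem (fset_set M) &, total le}.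
  move=> x y /memM Mx /memM My; rewrite /le.
  by case: (last_rdiv_total Mx My) => [->|->|->]; rewrite ?eqxx ?orbT.
have le_trans : transitive le.
  move=> y x w /predU1P[->//|xy] /predU1P[<-|yw]; apply/orP; right => //.
  exact: lt_braid_trans xy yw.
exists (sort le (fset_set M)); split; first by rewrite size_sort.
  apply: pairwise_sorted.
  have := sort_sorted_in le_total (allss (fset_set M)).
  rewrite sorted_pairwise // => ple.
  have : uniq (sort le (fset_set M)) by rewrite sort_uniq fset_uniq.
  rewrite uniq_pairwise => pne; move: (conj ple pne) => /andP.
  rewrite -pairwise_relI; apply: sub_pairwise => x y /= /andP[/predU1P[->|//]].
  by rewrite eqxx.
by move=> x; rewrite mem_sort => /memM[].
Qed.

End Height.

Theorem proposition3p11 (n d r : nat) :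
  (1 <= n)%N -> (1 <= d)%N -> (1 <= r <= n)%N ->
  height r (Delta n ^+ d)%g =
    (\sum_(s <- fset_set [set s | simple n s /\ rdiv (Delta r) s]) card_factor n d s)%N
  /\ (\sum_(s <- fset_set [set s | simple n s /\ rdiv (Delta r) s]) card_factor n d s)%N
     = card_factor n d.+1 (Delta r).
Proof.
move=> _ d0 /andP[r0 rn]; rewrite sum_card_factor //.
by split; [apply: height_card | rewrite card_factor_Delta].
Qed.
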